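(* For every $k\in\mathbb{N}$, the polynomial $\xi(G;x,y,z)$ is weakly distinguishing on the class $\mathcal{C}_k$ of graphs of genus at most $k$.
   Context: Graphs in $\mathcal{C}_k$ are finite, simple, labelled on $\{1,\dots,n\}$; the genus of a graph is the minimum genus of an orientable surface in which it embeds. The edge elimination polynomial $\xi(G;x,y,z)$ is defined on finite multigraphs by: for any edge $e$, $\xi(G)=\xi(G-e)+y\,\xi(G/e)+z\,\xi(G\dagger e)$, where $G-e$ deletes $e$, $G/e$ contracts $e$, and $G\dagger e$ deletes both endpoints of $e$ with all incident edges; $\xi(G\sqcup H)=\xi(G)\xi(H)$; $\xi(K_1)=x$, $\xi(\emptyset)=1$ (well defined, by Averbouch, Godlin and Makowsky). Two non-isomorphic graphs are $P$-mates if they have equal $P$; $U_{P,\mathcal{C}}(n)$ is the set of $G\in\mathcal{C}(n)$ with no $P$-mate in $\mathcal{C}$; $P$ is weakly distinguishing on $\mathcal{C}$ if $|U_{P,\mathcal{C}}(n)|/|\mathcal{C}(n)|\to0$. *)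

(* Defs.v *)
From HB Require Import structures.
From mathcomp Require Import all_boot all_order all_algebra all_fingroup.
From mathcomp Require Import boolp classical_sets reals topology normedtype sequences.
From mathcomp Require Import finset ring.
From mathcomp Require Import -(notations) mpoly.

Set Implicit Arguments.
Unset Strict Implicit.
Unset Printing Implicit Defensive.

Import GRing.Theory numFieldNormedType.Exports.
Local Open Scope ring_scope.

Definition simple_edges n (E : {set 'I_n * 'I_n}) : bool :=
  [forall x, (x, x) \notin E] &&
  [forall x, forall y, ((x, y) \in E) == ((y, x) \in E)].

(* A graph on the vertex set 'I_n; the set of ordered pairs is the adjacency
   relation, so every edge occurs in it in both directions. *)
Record sgraph n := SGraph {
  arcs : {set 'I_n * 'I_n};
  arcs_simple : simple_edges arcs }.

HB.instance Definition _ n := [isSub for @arcs n].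
HB.instance Definition _ n := [Finite of sgraph n by <:].

Definition adj n (G : sgraph n) (x y : 'I_n) : bool := (x, y) \in arcs G.

Definition isomorphic n m (G : sgraph n) (H : sgraph m) : Prop :=
  exists2 f : 'I_n -> 'I_m, bijective f &
    forall x y, adj H (f x) (f y) = adj G x y.

(* [C n] is the set of graphs of order [n] in the class [C]. *)
Definition graph_class := forall n, {set sgraph n}.

Definition mates A (P : forall n, sgraph n -> A) n m
    (G : sgraph n) (H : sgraph m) : Prop :=
  ~ isomorphic G H /\ P n G = P m H.

(* A mate is sought in the whole class, not only among graphs of order [n]. *)
Definition unique_graphs A (P : forall n, sgraph n -> A) (C : graph_class)
    n : {set sgraph n} :=
  [set G in C n | `[< ~ exists m (H : sgraph m), H \in C m /\ mates P G H >]].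

Definition weakly_distinguishing (R : realType) A (P : forall n, sgraph n -> A)
    (C : graph_class) : Prop :=
  (((fun n => #|unique_graphs P C n|%:R / #|C n|%:R : R) : nat -> R)
     @ \oo --> (0 : R))%classic.

(* A closed connected orientable surface, presented by a cell decomposition,
   that is, as a finite set of oriented polygons glued along their sides.  The
   darts are the oriented edges of the decomposition: [opp] reverses a dart, and
   [rot] sends a dart to the next one around its origin.  Vertices, edges and
   polygons are the orbits of [rot], of [opp], and of [rot \o opp].
   Transitivity on [set: dart] expresses connectedness, and it also rules out an
   empty set of darts. *)
Record surface := Surface {
  dart : finType;
  rot : {perm dart};
  opp : {perm dart};
  oppK : involutive opp;
  opp_neq : forall d, opp d != d;
  surface_connected :
    [transitive <<[set rot; opp]>>%g, on [set: dart] | 'P] }.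

Definition euler_char (S : surface) : int :=
  #|porbits (rot S)|%:Z - #|porbits (opp S)|%:Z + #|porbits (opp S * rot S)%g|%:Z.

Definition has_genus (S : surface) (g : nat) : Prop :=
  euler_char S = 2 - 2 * g%:Z.

(* The graph is drawn in the 1-skeleton of the surface: [f x] is a dart whose
   origin is the point representing [x], distinct vertices have distinct points,
   and an edge is represented by a dart joining the points of its ends.  The
   1-skeleton may have further vertices and edges, so that the complement of the
   drawing need not consist of discs; the cell decomposition being arbitrary, no
   generality is lost in drawing the edges of the graph as single edges.  Since
   the graph is simple, its edges occupy pairwise distinct edges of the
   1-skeleton. *)
Definition embeds n (G : sgraph n) (S : surface) : Prop :=
  exists f : 'I_n -> dart S,
    (forall x y, f x \in porbit (rot S) (f y) -> x = y) /\
    (forall x y, adj G x y -> exists d,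
       d \in porbit (rot S) (f x) /\ opp S d \in porbit (rot S) (f y)).

Definition embeds_in_genus n (G : sgraph n) (g : nat) : Prop :=
  exists S : surface, has_genus S g /\ embeds G S.

Definition is_genus n (G : sgraph n) (g : nat) : Prop :=
  embeds_in_genus G g /\ (forall h, embeds_in_genus G h -> (g <= h)%N).

Definition genus_class (k : nat) : graph_class :=
  fun n => [set G | `[< exists2 g, (g <= k)%N & is_genus G g >]].

(* A multigraph is given by its vertex set [V] and the list [s] of its edges,
   with repetitions for parallel edges; a loop is an edge [(u, u)], and the
   orientation of the pairs is irrelevant. *)
Definition map_edge (T T' : Type) (h : T -> T') (e : T * T) := (h e.1, h e.2).

Section EdgeElimination.
Variable T : finType.
Implicit Types (e f : T * T) (V : {set T}) (s : seq (T * T)).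

Definition merge e (w : T) : T := if w == e.2 then e.1 else w.

(* The image of [V] under [merge e] is [V] if [e] is a loop, and [V] minus the
   second end of [e] otherwise. *)
Definition contract_verts e V : {set T} := merge e @: V.
Definition contract_edges e s := map (map_edge (merge e)) s.

Definition touches e f : bool := (f.1 \in [set e.1; e.2]) || (f.2 \in [set e.1; e.2]).
Definition extract_verts e V : {set T} := V :\: [set e.1; e.2].
Definition extract_edges e s := [seq f <- s | ~~ touches e f].

Definition wf_edges V s : bool := all (fun e => (e.1 \in V) && (e.2 \in V)) s.

Variables (R : comNzRingType) (x y z : R).

(* The recursion eliminates the first edge of the list; [m] is fuel.  The choice
   of the edge does not matter: the recurrence holds for every edge by
   [xi_edge] below, and [xi_disjoint_union], [xi_K1] and [xi_empty] are the
   remaining defining equations of the edge elimination polynomial. *)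
Fixpoint xi_rec (m : nat) V s : R :=
  match m, s with
  | m'.+1, e :: s' =>
      xi_rec m' V s'
      + y * xi_rec m' (contract_verts e V) (contract_edges e s')
      + z * xi_rec m' (extract_verts e V) (extract_edges e s')
  | _, _ => x ^+ #|V|
  end.

Definition xi V s : R := xi_rec (size s) V s.

End EdgeElimination.

Section EdgeEliminationTheory.
Variables (R : comNzRingType) (x y z : R).

Lemma size_extract (T : finType) (e : T * T) s : (size (extract_edges e s) <= size s)%N.
Proof. by rewrite size_filter count_size. Qed.

Lemma xi_recE (T : finType) m (V : {set T}) s :
  (size s <= m)%N -> xi_rec x y z m V s = xi x y z V s.
Proof.
rewrite /xi; elim: {s}(size s) {-2}s (leqnn (size s)) m V => [|k IH] [|e s] //= hk m V.
- by case: m.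
- by case: m.
case: m => //= m hm; rewrite ltnS in hk; rewrite ltnS in hm.
have hc : (size (contract_edges e s) <= k)%N by rewrite size_map.
have hx : (size (extract_edges e s) <= k)%N by apply: leq_trans hk; apply: size_extract.
congr (_ + _ * _ + _ * _).
- by rewrite (IH s) // -?(IH s (size s)).
- by rewrite (IH _ hc) ?size_map // -(IH _ hc (size s)) ?size_map.
- by rewrite (IH _ hx) ?(leq_trans (size_extract _ _)) // -(IH _ hx (size s)) ?size_extract.
Qed.

Lemma xi_nil (T : finType) (V : {set T}) : xi x y z V [::] = x ^+ #|V|.
Proof. by []. Qed.

Lemma xi_cons (T : finType) (V : {set T}) e s :
  xi x y z V (e :: s) = xi x y z V s
    + y * xi x y z (contract_verts e V) (contract_edges e s)
    + z * xi x y z (extract_verts e V) (extract_edges e s).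
Proof. by rewrite {1}/xi /= !xi_recE ?size_map ?size_extract. Qed.


Local Notation xi := (xi x y z).

Lemma map_edge_comp (T T' T'' : Type) (g : T' -> T'') (h : T -> T') e :
  map_edge g (map_edge h e) = map_edge (g \o h) e.
Proof. by []. Qed.

Lemma wf_contract (T T' : finType) (h : T -> T') (V : {set T}) s :
  wf_edges V s -> wf_edges (h @: V) (map (map_edge h) s).
Proof.
move=> /allP wf; apply/allP => f /mapP [e /wf /andP[e1 e2] ->] /=.
by rewrite !imset_f.
Qed.

Lemma wf_extract (T : finType) e (V : {set T}) s :
  wf_edges V s -> wf_edges (extract_verts e V) (extract_edges e s).
Proof.
move=> /allP wf; apply/allP => f; rewrite mem_filter => /andP[nt /wf /andP[f1 f2]].
by move: nt; rewrite /touches negb_or !in_setD f1 f2 => /andP[-> ->].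
Qed.

Lemma merge_morph (T T' : finType) (h : T -> T') (V : {set T}) e w :
  {in V &, injective h} -> e.2 \in V -> w \in V ->
  merge (map_edge h e) (h w) = h (merge e w).
Proof. by move=> hI eV wV; rewrite /merge (inj_in_eq hI) //=; case: eqP. Qed.

Lemma xi_relabel (T T' : finType) (h : T -> T') (V : {set T}) s :
  {in V &, injective h} -> wf_edges V s ->
  xi (h @: V) (map (map_edge h) s) = xi V s.
Proof.
elim: {s}(size s) {-2}s (leqnn (size s)) V => [|k IH] [|e s] //= hk V hI wf.
- by rewrite !xi_nil card_in_imset.
- by rewrite !xi_nil card_in_imset.
rewrite ltnS in hk; case/andP: wf => /andP[e1 e2] wf.
have /allP wfs := wf.
have mV w : w \in V -> merge e w \in V by rewrite /merge; case: eqP.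
have sub : {subset contract_verts e V <= V} by move=> _ /imsetP[w wV ->]; apply: mV.
rewrite !xi_cons (IH s) //; congr (_ + _ * _ + _ * _).
- rewrite -(IH (contract_edges e s)) ?size_map //; last first.
  + exact: wf_contract.
  + by move=> u v uV vV; apply: hI; apply: sub.
  congr xi.
  + rewrite /contract_verts -!imset_comp; apply: eq_in_imset => w wV /=.
    exact: merge_morph hI _ _.
  + rewrite /contract_edges -!map_comp; apply/eq_in_map => f /wfs /andP[f1 f2].
    by rewrite /= /map_edge /= !(merge_morph hI).
- rewrite -(IH (extract_edges e s)) ?(leq_trans (size_extract _ _)) //; last first.
  + exact: wf_extract.
  + by move=> u v /setDP[uV _] /setDP[vV _]; apply: hI.
  congr xi.
  + apply/setP=> w; apply/setDP/imsetP.
    * case=> /imsetP[v vV ->]; rewrite !inE !(inj_in_eq hI) // => nv.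
      by exists v => //; rewrite in_setD !inE nv.
    * case=> v /setDP[vV nv] ->; rewrite imset_f //; split=> //.
      by move: nv; rewrite !inE !(inj_in_eq hI).
  + rewrite /extract_edges filter_map; congr map; apply/eq_in_filter=> f /wfs /andP[f1 f2].
    by rewrite /= /touches /= !inE !(inj_in_eq hI).
Qed.

Lemma xi_kernel (T : finType) (g h : T -> T) (V : {set T}) s :
  g \o h =1 g -> h \o g =1 h -> wf_edges V s ->
  xi (g @: V) (map (map_edge g) s) = xi (h @: V) (map (map_edge h) s).
Proof.
move=> gh hg wf; rewrite -(@xi_relabel _ _ g (h @: V)).
- rewrite -imset_comp -map_comp; congr xi; first by apply: eq_imset => w; rewrite gh.
  by apply: eq_map => f; rewrite /= /map_edge /=; congr pair; rewrite -[LHS]gh.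
- move=> _ _ /imsetP[u _ ->] /imsetP[v _ ->] E.
  by rewrite -(hg u) -(hg v) /=; congr h; rewrite -(gh u) -(gh v).
- exact: wf_contract.
Qed.

Lemma merge_invar (T T' : finType) (g : T -> T') e :
  g e.1 = g e.2 -> forall w, g (merge e w) = g w.
Proof. by move=> ge w; rewrite /merge; case: eqP => // ->. Qed.

Lemma merge_ends (T : finType) (e : T * T) : merge e e.1 = merge e e.2.
Proof. by rewrite /merge eqxx; case: eqP. Qed.

Lemma xi_flip (T : finType) (V : {set T}) u v s :
  wf_edges V ((u, v) :: s) -> xi V ((u, v) :: s) = xi V ((v, u) :: s).
Proof.
case/andP=> _ wf; rewrite !xi_cons; congr (_ + _ * _ + _ * _).
- apply: xi_kernel => // w /=; apply: merge_invar => /=; first exact: (esym (@merge_ends _ (u, v))).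
  exact: (esym (@merge_ends _ (v, u))).
- congr xi; first by rewrite /extract_verts /= setUC.
  by apply: eq_filter => f; rewrite /touches /= setUC.
Qed.

Lemma touchesC (T : finType) (e f : T * T) : touches e f = touches f e.
Proof.
rewrite /touches !inE.
rewrite (eq_sym f.1) (eq_sym f.1) (eq_sym f.2) (eq_sym f.2).
by case: (_ == _); case: (_ == _); case: (_ == _); case: (_ == _).
Qed.

Lemma contract_contract (T : finType) (e f : T * T) (V : {set T}) s :
  wf_edges V s ->
  xi (contract_verts (map_edge (merge e) f) (contract_verts e V))
     (contract_edges (map_edge (merge e) f) (contract_edges e s)) =
  xi (contract_verts (map_edge (merge f) e) (contract_verts f V))
     (contract_edges (map_edge (merge f) e) (contract_edges f s)).
Proof.
move=> wf; rewrite /contract_verts /contract_edges -!imset_comp -!map_comp.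
pose h (a b : T * T) w := merge (map_edge (merge a) b) (merge a w).
have ha a b : h a b a.1 = h a b a.2 by rewrite /h merge_ends.
have hb a b : h a b b.1 = h a b b.2.
  exact: (@merge_ends _ (map_edge (merge a) b)).
have hh a b w : h b a (h a b w) = h b a w.
  have inv c : h b a (merge a c) = h b a c by apply: merge_invar; apply: hb.
  by rewrite [h a b w]/h merge_invar //= !inv; apply: ha.
apply: (@xi_kernel _ (h e f) (h f e)) => // w; apply: hh.
Qed.

Lemma contract_extract_touch (T : finType) (e f : T * T) (V : {set T}) s :
  wf_edges V [:: e, f & s] -> touches e f ->
  xi (extract_verts (map_edge (merge e) f) (contract_verts e V))
     (extract_edges (map_edge (merge e) f) (contract_edges e s)) =
  xi (extract_verts e (extract_verts f V)) (extract_edges e (extract_edges f s)).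
Proof.
case/and3P=> /andP[e1 e2] /andP[f1 f2] /allP wf tef.
have key w : (merge e w \in [set merge e f.1; merge e f.2]) =
             (w \in [set e.1; e.2]) || (w \in [set f.1; f.2]).
  have me u : u \in [set e.1; e.2] -> merge e u = e.1.
    by move=> /set2P[] ->; rewrite ?merge_ends /merge eqxx.
  have e12 : e.1 \in [set merge e f.1; merge e f.2].
    by case/orP: tef => /me <-; rewrite !inE eqxx ?orbT.
  have [/me ->|nw] := boolP (w \in [set e.1; e.2]); first by [].
  have -> : merge e w = w.
    by move: nw; rewrite /merge !inE negb_or => /andP[_ /negPf ->].
  move: nw; rewrite /merge !inE negb_or => /andP[n1 n2].
  by case: (f.1 =P e.2) => [->|_]; case: (f.2 =P e.2) => [->|_];
     rewrite ?(negPf n1) ?(negPf n2).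
have fix_ w : w \notin [set e.1; e.2] -> merge e w = w.
  by rewrite /merge !inE negb_or => /andP[_ /negPf ->].
congr xi.
- apply/setP=> w; apply/setDP/setDP.
  + case=> /imsetP[v vV ->]; rewrite key negb_or => /andP[nv1 nv2].
    by rewrite fix_ // nv1 in_setD vV nv2.
  + case=> /setDP[wV nw2] nw1; rewrite -(fix_ _ nw1) imset_f // key.
    by rewrite (negPf nw1) (negPf nw2).
- rewrite /extract_edges /contract_edges filter_map -filter_predI.
  rewrite (@eq_filter _ _ (predI (fun g => ~~ touches e g) (fun g => ~~ touches f g))); last first.
    move=> g; rewrite /= {1}/touches /= !key /touches -negb_or; congr (~~ _).
    by case: (_ \in _); case: (_ \in _); case: (_ \in _).
  rewrite -[RHS]map_id; apply/eq_in_map => g; rewrite mem_filter => /andP[/andP[+ _] _].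
  by rewrite /touches negb_or => /andP[n1 n2]; rewrite /map_edge !fix_ //; case: g {n1 n2}.
Qed.

Lemma contract_extract_notouch (T : finType) (e f : T * T) (V : {set T}) s :
  wf_edges V [:: e, f & s] -> ~~ touches e f ->
  xi (extract_verts (map_edge (merge e) f) (contract_verts e V))
     (extract_edges (map_edge (merge e) f) (contract_edges e s)) =
  xi (contract_verts e (extract_verts f V)) (contract_edges e (extract_edges f s)).
Proof.
case/and3P=> /andP[e1 e2] /andP[f1 f2] /allP wf ntef.
have fix_ w : w \notin [set e.1; e.2] -> merge e w = w.
  by rewrite /merge !inE negb_or => /andP[_ /negPf ->].
have [nf1 nf2] : f.1 \notin [set e.1; e.2] /\ f.2 \notin [set e.1; e.2].
  by move: ntef; rewrite /touches negb_or => /andP.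
have [ne1 ne2] : e.1 \notin [set f.1; f.2] /\ e.2 \notin [set f.1; f.2].
  by move: ntef; rewrite touchesC /touches negb_or => /andP.
have -> : map_edge (merge e) f = f by rewrite /map_edge !fix_ //; case: f {f1 f2 ntef nf1 nf2 ne1 ne2}.
have key w : (merge e w \in [set f.1; f.2]) = (w \in [set f.1; f.2]).
  by rewrite /merge; case: eqP => // ->; rewrite (negPf ne1) (negPf ne2).
congr xi.
- apply/setP=> w; apply/setDP/imsetP.
  + case=> /imsetP[v vV ->]; rewrite key => nv.
    by exists v => //; rewrite in_setD nv.
  + by case=> v /setDP[vV nv] ->; rewrite imset_f // key.
- rewrite /extract_edges /contract_edges filter_map; congr map; apply: eq_filter => g.
  by rewrite /= /touches /= !key.
Qed.

Lemma extract_extract (T : finType) (e f : T * T) (V : {set T}) s :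
  xi (extract_verts e (extract_verts f V)) (extract_edges e (extract_edges f s)) =
  xi (extract_verts f (extract_verts e V)) (extract_edges f (extract_edges e s)).
Proof.
congr xi; first by apply/setP=> w; rewrite !in_setD andbCA.
by rewrite /extract_edges -!filter_predI; apply: eq_filter => g; rewrite /= andbC.
Qed.

Lemma xi_swap (T : finType) (e f : T * T) (V : {set T}) s :
  wf_edges V [:: e, f & s] -> xi V [:: e, f & s] = xi V [:: f, e & s].
Proof.
move=> wf; have wf' : wf_edges V [:: f, e & s].
  by move: wf; rewrite /wf_edges /= andbCA.
have wfs : wf_edges V s by case/and3P: wf.
have cc a b : contract_edges a (b :: s) = map_edge (merge a) b :: contract_edges a s by [].
have xc a b : extract_edges a (b :: s) =
  if touches a b then extract_edges a s else b :: extract_edges a s.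
  by rewrite /extract_edges /=; case: touches.
rewrite [LHS]xi_cons [RHS]xi_cons !cc !xc !xi_cons (contract_contract _ _ wfs).
rewrite (touchesC f e).
have [t|nt] /= := boolP (touches e f).
  rewrite (contract_extract_touch wf) // (contract_extract_touch wf') 1?touchesC //.
  by rewrite (extract_extract f e); ring.
have nt' : ~~ touches f e by rewrite touchesC.
rewrite (contract_extract_notouch wf) // (contract_extract_notouch wf') //.
by rewrite !xi_cons (extract_extract f e); ring.
Qed.

Lemma xi_perm (T : finType) (V : {set T}) s t :
  wf_edges V s -> perm_eq s t -> xi V s = xi V t.
Proof.
elim: {s}(size s) {-2}s (leqnn (size s)) V t => [|k IH] [|e s] //= hk V t wf st.
- by move: st; rewrite perm_sym => /perm_nilP ->.
- by move: st; rewrite perm_sym => /perm_nilP ->.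
have tail e' s1 s2 : (size s1 <= k)%N -> wf_edges V (e' :: s1) -> perm_eq s1 s2 ->
    xi V (e' :: s1) = xi V (e' :: s2).
  move=> hs /andP[_ wf1] p; rewrite !xi_cons (IH _ hs V s2) //.
  congr (_ + _ * _ + _ * _).
  - by apply: IH; rewrite ?size_map ?wf_contract ?perm_map.
  - apply: IH; rewrite ?wf_extract ?perm_filter //.
    exact: leq_trans (size_extract _ _) hs.
case: t st => [|f t] st; first by move/perm_size: st.
have sz := perm_size st; rewrite /= in sz.
have [ef|ef] := eqVneq e f; first by subst f; apply: tail => //; move: st; rewrite perm_cons.
have fs : f \in s.
  by have := perm_mem st f; rewrite !inE eqxx eq_sym (negPf ef).
have p1 : perm_eq s (f :: rem f s) by apply: perm_to_rem.
have wf1 : wf_edges V [:: e, f & rem f s].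
  by have := wf; rewrite /wf_edges /= (perm_all _ p1).
rewrite ltnS in hk; rewrite (tail e s (f :: rem f s)) // xi_swap //; apply: tail.
- by move: hk; rewrite (perm_size p1).
- by move: wf1; rewrite /wf_edges /= andbCA.
- rewrite -(perm_cons f); apply: perm_trans st; rewrite perm_sym.
  have := p1; rewrite -(perm_cons e) => /permPl ->.
  by apply/seq.permP => a /=; rewrite addnCA.
Qed.

Theorem xi_edge (T : finType) (V : {set T}) e s : wf_edges V s -> e \in s ->
  xi V s = xi V (rem e s)
    + y * xi (contract_verts e V) (contract_edges e (rem e s))
    + z * xi (extract_verts e V) (extract_edges e (rem e s)).
Proof. by move=> wf es; rewrite -xi_cons; apply: xi_perm => //; apply: perm_to_rem. Qed.

Lemma xi_union_step (T : finType) (W : {set T}) t :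
  wf_edges W t ->
  (forall V : {set T}, [disjoint V & W] -> xi (V :|: W) t = x ^+ #|V| * xi W t) ->
  forall (V : {set T}) s, [disjoint V & W] -> wf_edges V s ->
  xi (V :|: W) (s ++ t) = xi V s * xi W t.
Proof.
move=> /allP wfW base V s; elim: {s}(size s) {-2}s (leqnn (size s)) V => [|k IH] [|e s] //= hk V dVW.
- by rewrite base.
- by rewrite base.
rewrite ltnS in hk; case/andP=> /andP[e1 e2] wf.
have nW w : w \in W -> w \notin [set e.1; e.2].
  by move=> wW; apply: contraL wW => /set2P[] ->; rewrite (disjointFr dVW).
have mW w : w \in W -> merge e w = w.
  by move=> /nW; rewrite /merge !inE negb_or => /andP[_ /negPf ->].
rewrite !xi_cons (IH s) // !mulrDl -!mulrA; congr (_ + _ * _ + _ * _).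
- rewrite -IH ?size_map ?wf_contract //; last first.
    apply: disjointWl dVW; apply/fintype.subsetP => _ /imsetP[w wV ->].
    by rewrite /merge; case: eqP.
  rewrite /contract_verts imsetU /contract_edges map_cat; congr (xi (_ :|: _) (_ ++ _)).
  + by rewrite (eq_in_imset mW) imset_id.
  + rewrite -[RHS]map_id; apply/eq_in_map => f /wfW /andP[f1 f2].
    by rewrite /map_edge !mW //; case: f {f1 f2}.
- rewrite -IH ?wf_extract ?(leq_trans (size_extract _ _)) //; last first.
    by apply: disjointWl dVW; apply: finset.subsetDl.
  rewrite /extract_verts setDUl /extract_edges filter_cat; congr (xi (_ :|: _) (_ ++ _)).
  + by apply/setDidPl; rewrite disjoint_sym disjoints_subset; apply/fintype.subsetP=> w ew;
       rewrite inE; apply: contraL ew => /nW.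
  + by apply/all_filterP/allP => f /wfW /andP[f1 f2]; rewrite /touches !(negPf (nW _ _)).
Qed.

Theorem xi_disjoint_union (T : finType) (V W : {set T}) s t :
  [disjoint V & W] -> wf_edges V s -> wf_edges W t ->
  xi (V :|: W) (s ++ t) = xi V s * xi W t.
Proof.
move=> dVW wfV wfW; apply: xi_union_step => // {s V dVW wfV} V dVW.
rewrite setUC mulrC -[t in LHS]cats0 -(xi_nil V); apply: xi_union_step => //.
- move=> U dUV; rewrite !xi_nil -exprD cardsU.
  by move: dUV; rewrite -setI_eq0 => /eqP ->; rewrite cards0 subn0.
- by rewrite disjoint_sym.
Qed.

Lemma xi_K1 (T : finType) (v : T) : xi [set v] [::] = x.
Proof. by rewrite xi_nil cards1. Qed.

Lemma xi_empty (T : finType) : xi (set0 : {set T}) [::] = 1.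
Proof. by rewrite xi_nil cards0. Qed.

End EdgeEliminationTheory.

Definition edge_list n (G : sgraph n) : seq ('I_n * 'I_n) :=
  [seq e : 'I_n * 'I_n <- enum {: 'I_n * 'I_n} | (e.1 < e.2)%N && adj G e.1 e.2].

Definition mvar (i : 'I_3) : mpoly 3 int := mpolyX int (mnm1 i).

Definition edge_elimination n (G : sgraph n) : mpoly 3 int :=
  xi (mvar 0) (mvar 1) (mvar 2) [set: 'I_n] (edge_list G).

(* Main.v *)
Require Import Defs.
From mathcomp Require Import boolp classical_sets topology normedtype sequences.
From mathcomp Require Import all_boot all_order all_algebra.
From mathcomp Require Import reals.
From mathcomp Require Import all_fingroup.
From mathcomp Require Import -(notations) mpoly.
From mathcomp Require Import zify ring.
Import Defs GRing.Theory.

Set Implicit Arguments.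
Unset Strict Implicit.
Unset Printing Implicit Defensive.

(* Let T1 and T2 be the two trees obtained by hanging one fixed tree on eleven
   vertices (a path p1 ... p9 with an extra leaf at p2 and at p5) from a root r by
   an edge to p3, respectively to p6.  The rule
     xi(G + leaf at u) = (x + y) xi(G) + z xi(G - u)
   expresses xi of a graph with a pendant copy of T1 or T2 at r through xi(G) and
   xi(G - r), and both trees give the same coefficients; since the two graphs have
   different numbers of vertices with a prescribed neighbourhood pattern, every
   graph with a pendant copy of T1 has a mate, and the mate has the same genus.

   Hanging T1 from any vertex of a unique graph of order n, with arbitrary labels,
   produces about n^12 graphs of order n + 11 in the class, each of them boundedly
   often.  On the other hand the class grows by a factor O(n) when a vertex is
   added: by Euler's inequality at least half of the vertices of a large graph of
   genus at most k have degree at most 2, or have bounded degree and a neighbour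
   of bounded degree, and such a vertex can be deleted, or contracted into a
   neighbour, in such a way that only O(n) reconstructions are possible.  So a
   proportion O(1/n) of the class is unique. *)

(** * Euler's inequality *)

(** An embedding only places the graph inside the 1-skeleton of a surface, so its complement need
    not consist of discs.

    The two attaching vertices are pseudosimilar: deleting p3 or p6 from the tree leaves the same
    forest, namely a path on three vertices and a path on six vertices with a leaf at its second
    vertex. This is the source of the equal coefficients. Yet no automorphism sends p3 to p6, since
    the neighbour p2 of p3 carries two leaves and the neighbour p5 of p6 only one.

    An attached graph arises boundedly often because a unique graph has no pendant copy of T1
    itself: two copies that could be removed independently would contradict uniqueness, so any two
    must meet. As tree vertices have degree at most 3, all copies then lie in a set of bounded size.

    In the final balance the eleven labels of the tree are matched by eleven growth steps of a
    factor O(n) each, and the choice of the root is the one factor n that is gained. *)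

Section PermutationPairs.
Variable D : finType.
Implicit Types (a b s t : {perm D}) (x y z d : D).

Lemma porbitsJ s t : #|porbits (s ^ t)%g| = #|porbits s|.
Proof.
suff le s1 t1 : (#|porbits (s1 ^ t1)%g| <= #|porbits s1|)%N.
  by apply/eqP; rewrite eqn_leq le -{1}(conjgK t s) le.
suff -> : porbits (s1 ^ t1)%g = (fun A : {set D} => t1 @: A) @: porbits s1.
  exact: leq_imset_card.
have pJ x : t1 @: porbit s1 x = porbit (s1 ^ t1)%g (t1 x).
  apply/setP=> y; apply/imsetP/porbitP => [[z /porbitP[i ->] ->]|[i ->]].
    by exists i; rewrite -conjXg permJ.
  by exists ((s1 ^+ i)%g x); rewrite ?mem_porbit // -conjXg permJ.
apply/setP=> A; apply/imsetP/imsetP => [[x _ ->]|[_ /imsetP[x _ ->] ->]].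
  by exists (porbit s1 ((t1^-1)%g x)); rewrite ?imset_f // pJ permKV.
by exists (t1 x); rewrite // pJ.
Qed.

Lemma porbitsC s t : #|porbits (s * t)%g| = #|porbits (t * s)%g|.
Proof. by rewrite -(porbitsJ _ s) conjgE !mulgA mulVg mul1g. Qed.

Definition component a b x := orbit 'P <<[set a; b]>>%g x.
Definition components a b := [set component a b x | x in D].

Lemma component_eq a b x y : (component a b x = component a b y) <->
  (x \in component a b y).
Proof.
by split=> [/eqP|]; [rewrite orbit_eq_mem | move=> h; apply/eqP; rewrite orbit_eq_mem].
Qed.

Lemma component_gen a b g x : g \in <<[set a; b]>>%g -> component a b (g x) = component a b x.
Proof. by move=> gG; apply/component_eq; rewrite /component -[g x]/('P%act x g) mem_orbit. Qed.

Lemma component_l a b x : component a b (a x) = component a b x.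
Proof. by apply: component_gen; rewrite mem_gen // !inE eqxx. Qed.

Lemma component_r a b x : component a b (b x) = component a b x.
Proof. by apply: component_gen; rewrite mem_gen // !inE eqxx orbT. Qed.

Lemma component_invariant (A : eqType) (f : D -> A) a b x y :
    (forall z, f (a z) = f z) -> (forall z, f (b z) = f z) ->
  component a b x = component a b y -> f x = f y.
Proof.
move=> fa fb /component_eq /orbitP[g gG <-]; rewrite -[X in f X]/(g y).
case/gen_prodgP: gG => n [c cab ->] {g}.
elim: n c cab => [|n IH] c cab; first by rewrite big_ord0 perm1.
rewrite big_ord_recr /= permM -[RHS](IH (fun i => c (widen_ord (leqnSn n) i))) => [|i]; last exact: cab.
by case/set2P: (cab ord_max) => ->.
Qed.

(** An invariant [f] is constant on components, so distinct values force distinct components. All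
    lower bounds on the number of components come from exhibiting such an [f]. *)
Lemma card_components_le (A : finType) (f : D -> A) a b :
    (forall z, f (a z) = f z) -> (forall z, f (b z) = f z) ->
  (#|f @: D| <= #|components a b|)%N.
Proof.
move=> fa fb; pose g (C : {set D}) := if [pick x in C] is Some x then Some (f x) else None.
have sI : injective (@Some A) by move=> u v [].
rewrite -(card_imset _ sI) -imset_comp.
apply: leq_trans (leq_imset_card g _).
apply/subset_leq_card/subsetP => _ /imsetP[x _ ->] /=.
apply/imsetP; exists (component a b x); first exact: imset_f.
rewrite /g; case: pickP => [y /component_eq e|/(_ x)]; last by rewrite orbit_refl.
by congr Some; apply: component_invariant (esym e).
Qed.

Lemma componentsC a b : components a b = components b a.
Proof. by rewrite /components /component setUC. Qed.

(* Compares [2c + |D| - #a - #b - #(ab)], twice the sum of the genera of the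
   components of the map given by [a] and [b]. *)
Definition genus_le a' b' a b :=
  (#|components a' b'|.*2 + #|porbits a| + #|porbits b| + #|porbits (a * b)%g|
   <= #|components a b|.*2 + #|porbits a'| + #|porbits b'| + #|porbits (a' * b')%g|)%N.

Lemma genus_le_refl a b : genus_le a b a b.
Proof. exact: leqnn. Qed.

Lemma genus_le_trans a2 b2 a1 b1 a3 b3 :
  genus_le a1 b1 a2 b2 -> genus_le a2 b2 a3 b3 -> genus_le a1 b1 a3 b3.
Proof. by rewrite /genus_le; lia. Qed.

(** Neither permutation has to be an involution: the pair is a hypermap, in which the two
    permutations play symmetric roles. An operation shown harmless on the first is thus harmless on
    the second. *)
Lemma genus_leC a' b' a b : genus_le a' b' a b -> genus_le b' a' b a.
Proof. by rewrite /genus_le (componentsC a') (componentsC a) !(porbitsC b) !(porbitsC b'); lia. Qed.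

(** Identifying the classes of [x] and [y] in the new map yields a function invariant under the old
    map, and the identification loses at most one class. *)
Lemma components_split a b x y (t := tperm x y) (a' := (a * t)%g) :
  (#|components a' b| <= #|components a b| + (component a' b x != component a' b y))%N.
Proof.
pose q := component a' b.
pose f z := if q z == q y then q x else q z.
have ft z : f (t z) = f z.
  by rewrite /f /t; case: tpermP => // ->; rewrite eqxx; case: eqP => //; case: eqP.
have fa z : f (a z) = f z.
  by rewrite -ft -[t (a z)]permM /f /q component_l.
have fb z : f (b z) = f z by rewrite /f /q component_r.
suff le : (#|components a' b| <= #|f @: D| + (q x != q y))%N.
  by apply: leq_trans le _; rewrite leq_add2r; apply: card_components_le.
have [e|ne] /= := eqVneq (q x) (q y).
  rewrite addn0; apply/subset_leq_card/subsetP => _ /imsetP[z _ ->].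
  by apply/imsetP; exists z => //; rewrite /f e; case: eqP.
rewrite addn1; apply: leq_trans (_ : #|q y |: (f @: D)| <= _)%N; last first.
  by rewrite cardsU1; case: (_ \notin _).
apply/subset_leq_card/subsetP => _ /imsetP[z _ ->].
rewrite in_setU1; case: eqP => //= /eqP nz; apply/imsetP; exists z => //.
by rewrite /f ifN.
Qed.

(* If the product permutation loses a cycle, then [x] and [y] are still joined
   in the new map, so the number of components is unchanged; otherwise the
   product gains a cycle, which pays for a possible new component. *)
Lemma genus_le_split a b x y : x != y -> x \in porbit a y ->
  genus_le (a * tperm x y)%g b a b.
Proof.
move=> nxy xay; pose t := tperm x y; pose a' := (a * t)%g.
have := @components_split a b x y; rewrite -/t -/a'.
have := porbits_mul_tperm a x y; rewrite xay nxy /= addn0 -/t porbitsC -/a'.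
have := porbits_mul_tperm (b * a)%g x y; rewrite nxy /= -/t porbitsC -mulgA -/a'.
have := porbits_mul_tperm (t * (b * a))%g x y; rewrite nxy /= -/t mulgA tperm2 mul1g.
rewrite [X in _ + X.*2 = _]/= (porbitsC t) -(mulgA b) -/a' (porbitsC b a).
rewrite (porbitsC b a') /genus_le -/t -/a'.
case: (boolP (x \in porbit (b * a)%g y)) => /= [_|nx]; first by case: (_ != _); lia.
case: (boolP (x \in porbit (t * (b * a))%g y)) => /= [|_]; last by lia.
case/porbitP=> i e _.
suff -> : component a' b x = component a' b y by rewrite eqxx; lia.
have -> : y = ((b * a') ^+ i)%g x.
  have -> : (b * a' = (t * (b * a)) ^ t)%g by rewrite conjgE tpermV !mulgA tperm2 mul1g.
  by have := permJ ((t * (b * a)) ^+ i)%g t y; rewrite -e [t y]tpermR [t x]tpermL conjXg.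
rewrite component_gen // groupX // groupM // mem_gen // !inE eqxx ?orbT //.
Qed.

(** Cuts [x] out of its cycle: [x] becomes a fixed point and its predecessor is sent to [a x]. *)
Definition skip x a := (a * tperm x (a x))%g.

Lemma skip_id x a : skip x a x = x.
Proof. by rewrite permM tpermR. Qed.

Lemma skip_fix x a y : a y = y -> skip x a y = y.
Proof.
move=> ay; have [->|ne] := eqVneq y x; first exact: skip_id.
have nax : a x != a y by rewrite (inj_eq perm_inj) eq_sym.
by rewrite permM ay tpermD // 1?eq_sym // eq_sym -{1}ay.
Qed.

Lemma genus_le_skip x a b : genus_le (skip x a) (skip x b) a b.
Proof.
have sk a1 b1 : genus_le (skip x a1) b1 a1 b1.
  rewrite /skip; have [e|ne] := eqVneq x (a1 x).
    by rewrite -e tperm1 mulg1 genus_le_refl.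
  by apply: genus_le_split; rewrite // porbit_sym (mem_porbit _ 1).
apply: genus_le_trans (sk a b); apply: genus_leC; apply: genus_le_trans (sk b _).
exact: genus_le_refl.
Qed.

Lemma porbit_succ a x : porbit a (a x) = porbit a x.
Proof. exact: (porbit_perm a 1). Qed.

Lemma porbit_skip x a z : z != x -> porbit (skip x a) z = porbit a z :\ x.
Proof.
move=> zx; have sx := skip_id x a; apply/setP=> w; rewrite in_setD1; apply/idP/andP.
- case/porbitP=> i ->; elim: i => [|i [IH1 IH2]]; first by rewrite expg0 perm1 zx porbit_id.
  rewrite expgSr permM; set u := (skip x a ^+ i)%g z in IH1 IH2 *.
  split; first by rewrite -{2}sx (inj_eq perm_inj).
  have au c : c \in porbit a z -> a c \in porbit a z.
    by rewrite -!eq_porbit_mem porbit_succ.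
  rewrite permM; case: tpermP => [e|/perm_inj e|_ _]; last exact: au.
    by have := au _ IH2; rewrite e => /au.
  by rewrite e eqxx in IH1.
- case=> wx /porbitP[i e]; rewrite {}e in wx *.
  (* Strong induction, because where the orbit of [a] passes through [x] the orbit of [skip x a]
     jumps from the predecessor of [x] to its successor, which consumes two steps of [a]. *)
  elim/ltn_ind: i wx => -[|i] IH wx; first by rewrite expg0 perm1 porbit_id.
  have s1 c : c \in porbit (skip x a) z -> skip x a c \in porbit (skip x a) z.
    by rewrite -!eq_porbit_mem porbit_succ.
  move: wx; rewrite expgSr permM; set u := (a ^+ i)%g z => wx.
  have [ux|ux] := eqVneq u x; last first.
    have : skip x a u = a u.
      by rewrite permM tpermD // 1?eq_sym // (inj_eq perm_inj).
    by move=> <-; apply/s1/IH.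
  case: i IH @u ux wx => [|i] IH u ux wx; first by rewrite /u expg0 perm1 in ux; rewrite ux eqxx in zx.
  pose v := (a ^+ i)%g z; have uv : u = a v by rewrite /u expgSr permM.
  have vx : v != x by apply: contraNneq wx => e; rewrite ux -{1}e -uv ux.
  have <- : skip x a v = a u by rewrite permM -uv ux tpermL.
  by apply/s1/IH.
Qed.

Lemma genus_le_delete (X : {set D}) a b : exists a' b',
  [/\ genus_le a' b' a b,
      {in X, forall d, a' d = d}, {in X, forall d, b' d = d},
      {in ~: X, forall d, porbit a' d = porbit a d :\: X} &
      {in ~: X, forall d, porbit b' d = porbit b d :\: X}].
Proof.
have [m] := ubnP #|X|; elim: m X => // m IH X; rewrite ltnS => hX.
have [->|[x xX]] := set_0Vmem X.
  exists a, b; split=> [|d|d|d _|d _]; rewrite ?inE ?setD0 //; exact: genus_le_refl.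
have [|a1 [b1 [le1 fa fb pa pb]]] := IH (X :\ x).
  by move: hX; rewrite (cardsD1 x X) xX; lia.
exists (skip x a1), (skip x b1).
have key (c c1 : {perm D}) : {in X :\ x, forall d, c1 d = d} ->
    {in ~: (X :\ x), forall d, porbit c1 d = porbit c d :\: (X :\ x)} ->
    {in X, forall d, skip x c1 d = d} /\
    {in ~: X, forall d, porbit (skip x c1) d = porbit c d :\: X}.
  move=> fc pc; split=> d; rewrite ?inE => dX.
    have [->|dx] := eqVneq d x; first exact: skip_id.
    by apply/skip_fix/fc; rewrite !inE dx.
  have dx : d != x by apply: contraNneq dX => ->.
  rewrite porbit_skip // pc ?inE ?negb_and ?dX ?orbT //.
  by apply/setP=> w; rewrite !inE; case: eqP => [->|]; rewrite ?xX //= andbF.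
have [? ?] := key _ _ fa pa; have [? ?] := key _ _ fb pb; split=> //.
exact: genus_le_trans (genus_le_skip x a1 b1) le1.
Qed.

End PermutationPairs.

Section OrbitCounts.
Variable D : finType.
Implicit Types (a b s t : {perm D}) (x y z d : D) (X : {set D}).

Lemma trivIset_porbits s : trivIset (porbits s).
Proof.
apply/trivIsetP => _ _ /imsetP[x _ ->] /imsetP[y _ ->]; apply: contraNT.
rewrite -setI_eq0 => /set0Pn[z /setIP[zx zy]].
by rewrite eq_porbit_mem; move: zx; rewrite porbit_sym; rewrite -!eq_porbit_mem in zy * => /eqP->.
Qed.

Lemma porbit_fixed s x : s x = x -> porbit s x = [set x].
Proof.
move=> sx; apply/setP=> y; rewrite inE; apply/porbitP/eqP => [[i ->]|->]; last by exists 0; rewrite expg0 perm1.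
by elim: i => [|i IH]; rewrite ?expg0 ?perm1 // expgSr permM IH.
Qed.

Lemma card_porbits_fixed m s X : {in X, forall d, s d = d} ->
    {in ~: X, forall d, (m <= #|porbit s d|)%N} ->
  (m * #|porbits s| <= m * #|X| + #|~: X|)%N.
Proof.
move=> fX hm; pose P2 := porbit s @: ~: X.
have sub : porbits s \subset ((@set1 D) @: X) :|: P2.
  apply/subsetP=> _ /imsetP[d _ ->]; rewrite in_setU.
  have [dX|dX] := boolP (d \in X); first by rewrite porbit_fixed ?fX ?imset_f.
  by rewrite (imset_f (porbit s)) ?orbT // inE.
have P2s : P2 \subset porbits s by apply: imsetS; apply/subsetP.
have tr : trivIset P2 by apply: trivIsetS P2s (trivIset_porbits s).
have cov : cover P2 \subset ~: X.
  apply/bigcupsP => _ /imsetP[d dX ->]; apply/subsetP=> e ed; rewrite inE.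
  apply: contraTN dX => eX; rewrite inE negbK.
  by move: ed; rewrite porbit_sym porbit_fixed ?fX // inE => /eqP ->.
have le2 : (m * #|P2| <= #|~: X|)%N.
  apply: leq_trans (subset_leq_card cov).
  rewrite -(eqP tr) mulnC -sum_nat_const; apply: leq_sum => _ /imsetP[d dX ->].
  exact: hm.
have leP : (#|porbits s| <= #|X| + #|P2|)%N.
  apply: leq_trans (subset_leq_card sub) _.
  by rewrite cardsU (leq_trans (leq_subr _ _)) // leq_add2r leq_imset_card.
by apply: leq_trans (leq_mul (leqnn m) leP) _; rewrite mulnDr leq_add2l.
Qed.

Lemma card_le_porbits m s : (forall d, #|porbit s d| <= m)%N -> (#|D| <= m * #|porbits s|)%N.
Proof.
move=> hm; have : [set: D] \subset cover (porbits s).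
  by apply/subsetP=> d _; apply/bigcupP; exists (porbit s d); rewrite ?imset_f ?porbit_id.
move/subset_leq_card; rewrite cardsT => /leq_trans; apply.
rewrite -(eqP (trivIset_porbits s)) mulnC -sum_nat_const; apply: leq_sum => _ /imsetP[d _ ->].
exact: hm.
Qed.

(** Sending each dart of [X] to itself and all others to one common value is invariant; [d] realises
    the common value, whence the strict inequality. *)
Lemma card_components_fixed a b X d : d \notin X ->
    {in X, forall d, a d = d} -> {in X, forall d, b d = d} ->
  (#|X| < #|components a b|)%N.
Proof.
move=> dX fa fb; pose f d := if d \in X then Some d else None.
have inv (c : {perm D}) : {in X, forall d, c d = d} -> forall z, f (c z) = f z.
  move=> fc z; rewrite /f; have [zX|zX] := boolP (z \in X); first by rewrite fc ?zX.
  by rewrite ifN //; apply: contraNN zX => h; rewrite -(perm_inj (fc _ h)).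
apply: leq_trans (card_components_le (inv _ fa) (inv _ fb)).
have sI : injective (@Some D) by move=> u v [].
rewrite -(card_imset _ sI) -add1n -(cards1 (@None D)) -cardsUI.
rewrite [_ :&: _](_ : _ = set0); last first.
  by apply/setP=> u; rewrite !inE; case: eqP => // ->; apply/negP => /imsetP[].
rewrite cards0 addn0; apply/subset_leq_card/subsetP => u.
case/setU1P => [->|/imsetP[e eX ->]]; apply/imsetP; first by exists d; rewrite // /f ifN.
by exists e; rewrite // /f eX.
Qed.

End OrbitCounts.

Section GraphBasics.
Variables (n : nat) (G : sgraph n).

Lemma adj_irr x : adj G x x = false.
Proof. by case/andP: (arcs_simple G) => /forallP/(_ x)/negPf. Qed.

Lemma adj_sym x y : adj G x y = adj G y x.
Proof. by case/andP: (arcs_simple G) => _ /forallP/(_ x)/forallP/(_ y)/eqP. Qed.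

Lemma adj_neq x y : adj G x y -> x != y.
Proof. by apply: contraTneq => ->; rewrite adj_irr. Qed.

End GraphBasics.

(** * Euler's inequality for an embedded graph *)

Section EulerBound.
Variables (n : nat) (G : sgraph n) (S : surface) (g : nat).
Hypotheses (Sg : has_genus S g) (GS : embeds G S).
Hypothesis no_K2 : forall x y, adj G x y ->
  (exists2 w, w != x & adj G y w) \/ (exists2 w, w != y & adj G x w).

(** All darts that do not carry the graph are deleted, and every remaining face has length at least
    [m]. A face of length 2 would come from an edge forming a whole component, which [no_K2]
    excludes. Since [arcs] counts each edge twice, this is Euler's formula multiplied by [2 * m]. *)
Lemma euler_bound m (V : {set 'I_n}) : (forall x y, adj G x y -> x \in V) -> m = 3 \/
    m = 4 /\ (forall x y w, adj G x y -> adj G y w -> adj G w x -> False) ->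
  (m * #|arcs G| <= 2 * m * #|V| + 2 * #|arcs G| + 4 * m * g)%N.
Proof.
move=> hV hm; have [f [fI fE]] := GS.
pose P x y d := (d \in porbit (rot S) (f x)) && (opp S d \in porbit (rot S) (f y)).
pose d0 x y := odflt (f x) [pick d | P x y d].
have d0P x y : adj G x y -> P x y (d0 x y).
  case/fE=> d [h1 h2]; rewrite /d0; case: pickP => [//|/(_ d)].
  by rewrite /P h1 h2.
(* Only the pairs with [x < y] receive a chosen dart; the reversed pair takes its opposite, so that
   the set [K] of darts carrying the graph is closed under [opp]. *)
pose de (x y : 'I_n) := if (x < y)%N then d0 x y else opp S (d0 y x).
have deP x y : adj G x y -> P x y (de x y).
  move=> xy; rewrite /de; case: ifP => _; first exact: d0P.
  by move: xy; rewrite adj_sym => /d0P/andP[h1 h2]; rewrite /P oppK h1 h2.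
have deN x y : adj G x y -> de y x = opp S (de x y).
  move=> /adj_neq ne; rewrite /de; case: ltngtP => // [_|/val_inj e]; first by rewrite oppK.
  by rewrite e eqxx in ne.
have deI x y u v : adj G x y -> adj G u v -> de x y = de u v -> x = u /\ y = v.
  move=> /deP/andP[h1 h2] /deP/andP[h3 h4] e; rewrite -e in h3 h4.
  rewrite -!eq_porbit_mem in h1 h2 h3 h4.
  by split; apply: fI; rewrite -eq_porbit_mem -?(eqP h1) -?(eqP h2).
pose K := [set de p.1 p.2 | p in arcs G].
have KP d : d \in K -> exists x y, adj G x y /\ d = de x y.
  by case/imsetP=> -[x y] xy ->; exists x, y.
have Kde x y : adj G x y -> de x y \in K by move=> xy; apply/imsetP; exists (x, y).
have cardK : #|K| = #|arcs G|.
  by apply: card_in_imset => -[x y] [u v] xy uv /= /deI[] // -> ->.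
have [K0|[k0 k0K]] := set_0Vmem K; first by rewrite -cardK K0 cards0; lia.
have [a' [b' [le fa fb pa pb]]] := genus_le_delete (~: K) (rot S) (opp S).
rewrite setCK in pa pb.
have inK (c c' : {perm dart S}) d : d \in K -> {in K, forall d, porbit c' d = porbit c d :\: ~: K} ->
    c' d \in K.
  move=> dK pc; have : c' d \in porbit c' d by rewrite (mem_porbit _ 1).
  by rewrite pc // !inE negbK => /andP[].
have b'E d : d \in K -> b' d = opp S d.
  move=> dK; have od : opp S d \in K.
    by have [x [y [xy ->]]] := KP _ dK; rewrite -deN // Kde // adj_sym.
  have pE : porbit b' d = [set d; opp S d].
    rewrite pb //; apply/setP=> e; rewrite !inE negbK; apply/andP/orP.
      case=> _ /porbitP[i ->]; elim: i => [|i IH]; first by rewrite expg0 perm1; left.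
      by rewrite expgSr permM; case: IH => /eqP ->; rewrite ?oppK eqxx; [right|left].
    by case=> /eqP ->; rewrite ?porbit_id ?(mem_porbit _ 1) ?dK ?od.
  have : b' d \in porbit b' d by rewrite (mem_porbit _ 1).
  rewrite pE => /set2P[] // /porbit_fixed e.
  have : opp S d \in porbit b' d by rewrite pE !inE eqxx orbT.
  by rewrite e inE (negPf (opp_neq d)).
have a'E x y w : adj G x y -> adj G x w -> de x w \in porbit a' (de x y).
  move=> xy xw; rewrite pa ?Kde // !inE negbK Kde //=.
  have /andP[h1 _] := deP _ _ xy; have /andP[h2 _] := deP _ _ xw.
  by rewrite -!eq_porbit_mem in h1 h2 *; rewrite (eqP h1) (eqP h2).
(* The face permutation of the remaining map: it sends the dart from [x] to [y] to some dart from
   [y] to some [w]. *)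
pose phi := (b' * a')%g.
have phiE x y : adj G x y -> phi (de x y) = a' (de y x).
  by move=> xy; rewrite permM b'E ?Kde // -deN.
have phiP x y : adj G x y -> exists2 w, adj G y w & phi (de x y) = de y w.
  move=> xy; have yx : adj G y x by rewrite adj_sym.
  have aK := inK _ _ _ (Kde _ _ yx) pa.
  have [u [w [uw e]]] := KP _ aK.
  have : a' (de y x) \in porbit a' (de y x) by rewrite (mem_porbit _ 1).
  rewrite pa ?Kde // e !inE => /andP[_ h].
  have /andP[h1 _] := deP _ _ yx; have /andP[h2 _] := deP _ _ uw.
  suff uy : u = y by subst u; exists w; rewrite // phiE.
  by apply: fI; rewrite -!eq_porbit_mem in h h1 h2 *; rewrite -(eqP h2) (eqP h).
have end1 x y : adj G x y -> a' (de x y) = de x y -> forall w, adj G x w -> w = y.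
  move=> xy /porbit_fixed e w xw; have := a'E _ _ _ xy xw.
  by rewrite e inE => /eqP/deI[].
(* Length 1 would be a loop. Length 2 makes both ends have a single neighbour. Length 3 is a
   triangle, which is excluded when [m = 4]. *)
have face d : d \in K -> (m <= #|porbit phi d|)%N.
  case/KP=> x [y [xy ->]]; rewrite leqNgt; apply/negP => lt.
  have yx : adj G y x by rewrite adj_sym.
  have := iter_porbit phi (de x y); have := card_porbit_neq0 phi (de x y).
  have [w yw e1] := phiP _ _ xy; have [v wv e2] := phiP _ _ yw.
  have [u vu e3] := phiP _ _ wv.
  have : (#|porbit phi (de x y)| < 4)%N by case: hm lt => [->|[-> _]]; lia.
  case ej: #|_| lt => [//|[|[|[|//]]]] lt _ _ /=; rewrite e1 => h.
  - by have [e _] := deI _ _ _ _ yw xy h; rewrite e adj_irr in xy.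
  - rewrite e2 in h; have [e _] := deI _ _ _ _ wv xy h; subst w.
    rewrite phiE // in e1; rewrite h phiE // in e2.
    have ey := end1 _ _ yx e1; have ex := end1 _ _ xy e2.
    by case: (no_K2 xy) => -[t /eqP nt]; [move/ey|move/ex].
  - rewrite e2 e3 in h; have [e _] := deI _ _ _ _ vu xy h; subst v.
    case: hm lt => [->|[_ tri] _]; first by [].
    exact: (tri x y w).
have fphi : {in ~: K, forall d, phi d = d} by move=> d dX; rewrite permM fb ?fa.
have cphi : (m * #|porbits phi| <= m * #|~: K| + #|K|)%N.
  by rewrite -[in X in _ + X](setCK K); apply: card_porbits_fixed fphi _ => d; rewrite setCK; apply: face.
have cb : (2 * #|porbits b'| <= 2 * #|~: K| + #|K|)%N.
  rewrite -[in X in _ + X](setCK K); apply: card_porbits_fixed fb _ => d; rewrite setCK => dK.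
  have <- : #|[set d; opp S d]| = 2 by rewrite cards2 eq_sym opp_neq.
  apply/subset_leq_card/subsetP => e; rewrite pb // !inE negbK.
  case/orP=> /eqP ->; first by rewrite dK porbit_id.
  rewrite (mem_porbit _ 1) andbT.
  by rewrite -b'E // (inK _ _ _ _ pb).
have ca : (#|porbits a'| <= #|~: K| + #|V|)%N.
  have sub : porbits a' \subset (@set1 _ @: ~: K) :|: [set porbit (rot S) (f x) :\: ~: K | x in V].
    apply/subsetP=> _ /imsetP[d _ ->]; rewrite inE; apply/orP.
    have [dK|dK] := boolP (d \in K); [right|left].
      have [x [y [xy e]]] := KP _ dK; apply/imsetP; exists x; first exact: hV xy.
      by rewrite pa // e; congr (_ :\: _); apply/eqP; rewrite eq_porbit_mem; case/andP: (deP _ _ xy).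
    by rewrite porbit_fixed ?imset_f ?fa ?inE.
  apply: leq_trans (subset_leq_card sub) _.
  rewrite cardsU (leq_trans (leq_subr _ _)) // leq_add ?leq_imset_card //.
have cD : (#|~: K| + #|K| <= 2 * #|porbits (opp S)|)%N.
  rewrite addnC cardsC; apply: card_le_porbits => d.
  rewrite -(ltnS _ 2) ltnNge; apply/negP=> lt.
  have := uniq_traject_porbit (opp S) d; case: #|_| lt => [|[|[|j]]] //= _.
  by rewrite !inE oppK eqxx !orbT.
have c1 : #|components (rot S) (opp S)| = 1%N.
  have /imsetP[d _ e] := surface_connected S.
  rewrite (_ : components _ _ = [set component (rot S) (opp S) d]) ?cards1 //.
  apply/setP=> A; rewrite inE; apply/imsetP/eqP => [[z _ ->]|->]; last by exists d.
  by apply/component_eq; rewrite /component -e inE.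
(* Every deleted dart is a component and at least one further component remains. The deleted darts
   then occur three times on each side of the final inequality and cancel. *)
have c2 : (#|~: K| < #|components a' b'|)%N by apply: (@card_components_fixed _ _ _ _ k0); rewrite // inE k0K.
move: Sg le; rewrite /has_genus /euler_char /genus_le (porbitsC (rot S)) (porbitsC a') c1 -/phi -cardK.
case: hm cphi => [->|[-> _]] cphi; lia.
Qed.

End EulerBound.

(** * Surgery on surfaces *)

Lemma porbit_invariant (D : finType) (A : Type) (F : D -> A) (s : {perm D}) x y :
  (forall z, F (s z) = F z) -> y \in porbit s x -> F y = F x.
Proof.
move=> Fs /porbitP[i ->]; elim: i => [|i IH]; first by rewrite expg0 perm1.
by rewrite expgSr permM Fs.
Qed.

Lemma transitive_component (D : finType) (a b : {perm D}) d0 :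
    (forall d, component a b d = component a b d0) ->
  [transitive <<[set a; b]>>%g, on [set: D] | 'P].
Proof.
move=> h; apply/imsetP; exists d0; rewrite ?inE //; apply/setP=> d; rewrite inE.
by apply/esym/component_eq.
Qed.

Lemma component_surface (S : surface) (d e : dart S) :
  component (rot S) (opp S) d = component (rot S) (opp S) e.
Proof.
have /imsetP[d0 _ h] := surface_connected S.
suff c z : component (rot S) (opp S) z = component (rot S) (opp S) d0 by rewrite !c.
by apply/component_eq; rewrite /component -h inE.
Qed.

(** Only the vertices of [A] are constrained, so a drawing can be enlarged one vertex at a time
    without changing the graph or its vertex type. *)
Definition drawn k n (G : sgraph n) (A : {set 'I_n}) : Prop :=
  exists S g, [/\ (g <= k)%N, has_genus S g & exists f : 'I_n -> dart S,
    {in A &, forall x y, f x \in porbit (rot S) (f y) -> x = y} /\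
    {in A &, forall x y, adj G x y -> exists d,
       d \in porbit (rot S) (f x) /\ opp S d \in porbit (rot S) (f y)}].

(** An embedding of genus at most [k] suffices: the least genus of an embedding then exists and is
    no larger. *)
Lemma genus_class_drawn k n (G : sgraph n) :
  G \in genus_class k n <-> drawn k G [set: 'I_n].
Proof.
rewrite inE; split=> [/asboolP[g gk [[S [Sg [f [f1 f2]]]] _]]|[S [g [gk Sg [f [f1 f2]]]]]].
  by exists S, g; split=> //; exists f; split=> x y _ _; [apply: f1 | apply: f2].
apply/asboolP; have ex : exists g, `[< embeds_in_genus G g >].
  exists g; apply/asboolP; exists S; split=> //; exists f.
  by split=> x y; [apply: f1 | apply: f2]; rewrite inE.
case: (ex_minnP ex) => m /asboolP mG hmin0.
have hmin h : embeds_in_genus G h -> (m <= h)%N by move=> hG; apply: hmin0; apply/asboolP.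
exists m; last by split.
apply: leq_trans gk; apply: hmin; exists S; split=> //; exists f.
by split=> x y; [apply: f1 | apply: f2]; rewrite inE.
Qed.

Lemma drawn_morph k n m (G : sgraph n) (H : sgraph m) (h : 'I_m -> 'I_n) (A : {set 'I_n}) (B : {set 'I_m}) :
    {in B &, injective h} -> {in B, forall x, h x \in A} ->
    {in B &, forall x y, adj H x y -> adj G (h x) (h y)} ->
  drawn k G A -> drawn k H B.
Proof.
move=> hI hA hG [S [g [gk Sg [f [f1 f2]]]]]; exists S, g; split=> //; exists (f \o h).
split=> x y xB yB /=; first by move/f1 => e; apply: hI => //; apply: e; apply: hA.
by move/(hG _ _ xB yB); apply: f2; apply: hA.
Qed.

(** * Contracting an edge of a surface *)

Section Contract.
Variables (S : surface) (d : dart S).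
(** [r] precedes [d] around its origin. Composing with [t] splices the cycle of [opp S d] into that
    of [d], so that [opp S d] is immediately followed by [d]. The edge is not removed: it becomes a
    loop at the merged vertex. *)
Let r := ((rot S)^-1 d)%g.
Let t := tperm (opp S d) r.
Let rot' := (t * rot S)%g.
Hypothesis nloop : opp S d \notin porbit (rot S) d.

Let nr : opp S d \notin porbit (rot S) r.
Proof. by rewrite -porbit_succ permKV. Qed.

Let ne : opp S d != r.
Proof. by apply: contraNneq nr => ->; rewrite porbit_id. Qed.

Let card_rot' : #|porbits rot'|.+1 = #|porbits (rot S)|.
Proof. by have := porbits_mul_tperm (rot S) (opp S d) r; rewrite nr ne /= -/t -/rot'; lia. Qed.

(** Composing [rot'] with [t] again recovers [rot S], which has one cycle more; hence [t] splits a
    cycle of [rot'] that contains both points. *)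
Let joined : opp S d \in porbit rot' r.
Proof.
have := porbits_mul_tperm rot' (opp S d) r; rewrite /= -/t /rot' mulgA tperm2 mul1g -/rot' ne.
by have := card_rot'; case: (_ \in _) => /=; lia.
Qed.

Let compt (A : Type) (F : dart S -> A) : (forall z, F (rot' z) = F z) -> forall z, F (t z) = F z.
Proof. by move=> Fr z; rewrite /t; case: tpermP => // ->; have := porbit_invariant Fr joined. Qed.

Let inv (A : Type) (F : dart S -> A) : (forall z, F (rot' z) = F z) -> forall z, F (rot S z) = F z.
Proof. by move=> Fr z; rewrite -(compt Fr z) -(Fr (t z)) permM /t tpermK. Qed.

Let conn : [transitive <<[set rot'; opp S]>>%g, on [set: dart S] | 'P].
Proof.
apply: (@transitive_component _ _ _ d) => e.
apply: component_invariant (component_surface e d); last exact: component_r.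
by apply: inv; exact: component_l.
Qed.

Definition contract_surface := Surface (@oppK S) (@opp_neq S) conn.

(** One vertex is lost, and the loop [d] bounds a new face of length 1, so the Euler characteristic
    is unchanged. *)
Lemma contract_genus g : has_genus S g -> has_genus contract_surface g.
Proof.
rewrite /has_genus /euler_char /=; have := card_rot'.
have -> : #|porbits (opp S * rot')%g| = #|porbits (opp S * rot S)%g|.+1.
  rewrite porbitsC /rot' -mulgA (porbitsC (opp S))  .
  have := porbits_mul_tperm (rot S * opp S)%g (opp S d) r.
  have -> : opp S d \in porbit (rot S * opp S)%g r.
    by rewrite -porbit_succ permM /r permKV porbit_id.
  by rewrite ne /= -/t double0 addn0 addn1.
by move: #|porbits rot'| #|porbits (rot S)| #|porbits (opp S)| #|porbits (opp S * rot S)%g| => *; lia.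
Qed.

Lemma contract_porbit x y : x \in porbit (rot S) y -> x \in porbit rot' y.
Proof.
move=> xy; rewrite -eq_porbit_mem; apply/eqP.
apply: (porbit_invariant (F := porbit rot')) xy.
by apply: inv => z; exact: porbit_succ.
Qed.

Lemma contract_joined x y : x \in porbit (rot S) d -> y \in porbit (rot S) (opp S d) ->
  x \in porbit rot' y.
Proof.
move=> /contract_porbit xd /contract_porbit yd; rewrite -eq_porbit_mem in xd.
rewrite -eq_porbit_mem in yd; rewrite -eq_porbit_mem (eqP xd) (eqP yd) eq_porbit_mem.
have := joined; rewrite porbit_sym -!eq_porbit_mem => /eqP <-.
by rewrite eq_porbit_mem contract_porbit // -[d in d \in _](permKV (rot S)) (mem_porbit _ 1).
Qed.

Lemma contract_separated x y : x \in porbit rot' y ->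
    x \notin porbit (rot S) (opp S d) -> y \notin porbit (rot S) (opp S d) ->
  x \in porbit (rot S) y.
Proof.
(* Records the old vertex of [z], with the vertex of [opp S d] identified with that of [d]; this is
   invariant under the new rotation. *)
pose I z := if z \in porbit (rot S) (opp S d) then porbit (rot S) d else porbit (rot S) z.
move=> xy nx ny; have : I x = I y.
  apply: (porbit_invariant _ xy) => z; rewrite /rot' permM.
  have Ir w : I (rot S w) = I w by rewrite /I -!eq_porbit_mem !porbit_succ.
  have Io : I (opp S d) = porbit (rot S) d by rewrite /I porbit_id.
  have Ip : I r = porbit (rot S) d by rewrite /I porbit_sym (negPf nr) -porbit_succ permKV.
  by rewrite Ir /t; case: tpermP => // ->; rewrite Io Ip.
by rewrite /I !ifN // => /eqP; rewrite eq_porbit_mem.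
Qed.

End Contract.

(** * Adding a pendant edge to a surface *)

Section Leaf.
Variables (S : surface) (d0 : dart S).
(** The new edge consists of [inr true], inserted just before [d0] in the rotation around its
    origin, and [inr false], alone at the new vertex. *)
Let D : finType := (dart S + bool)%type.

Let lift_fun (s : {perm dart S}) (z : D) : D := if z is inl d then inl (s d) else z.
Let lift_inj s : injective (lift_fun s).
Proof. by move=> [x|x] [y|y] //= [] /perm_inj->. Qed.
Let lf s : {perm D} := perm (@lift_inj s).

Let lfE s d : lf s (inl d) = inl (s d). Proof. by rewrite permE. Qed.
Let lfE' s b : lf s (inr b) = inr b. Proof. by rewrite permE. Qed.

Let lfM s1 s2 : lf (s1 * s2)%g = (lf s1 * lf s2)%g.
Proof. by apply/permP => -[d|b]; rewrite permM ?lfE ?lfE' ?permM. Qed.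

Let card_lf s : #|porbits (lf s)| = (#|porbits s| + 2)%N.
Proof.
have inlI : injective (inl : dart S -> D) by move=> ? ? [].
have pl d : porbit (lf s) (inl d) = inl @: porbit s d.
  apply/setP=> z; apply/porbitP/imsetP => [[i ->]|[e /porbitP[i ->] ->]].
    exists ((s ^+ i)%g d); first exact: mem_porbit.
    by elim: i => [|i IH]; rewrite ?expg0 ?perm1 // !expgSr !permM IH lfE.
  by exists i; elim: i => [|i IH]; rewrite ?expg0 ?perm1 // !expgSr !permM -IH lfE.
have pr b : porbit (lf s) (inr b) = [set inr b] by apply: porbit_fixed.
have -> : porbits (lf s) = ((fun A : {set dart S} => inl @: A : {set D}) @: porbits s)
    :|: [set [set inr true]; [set inr false]].
  apply/setP=> A; rewrite in_setU; apply/imsetP/orP.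
    case=> -[d|b] _ ->; [left|right]; first by rewrite pl !imset_f.
    by rewrite pr !inE; case: b; rewrite eqxx ?orbT.
  case=> [/imsetP[_ /imsetP[d _ ->] ->]|]; first by exists (inl d); rewrite ?pl.
  by rewrite !inE => /orP[] /eqP ->; [exists (inr true)|exists (inr false)]; rewrite ?pr.
rewrite cardsU card_imset; last exact: imset_inj.
rewrite cards2 (_ : [set _] != [set _]); last first.
  by apply/eqP => /setP/(_ (inr true)); rewrite !inE.
rewrite [_ :&: _](_ : _ = set0) ?cards0 ?subn0 //.
apply/setP=> A; rewrite !inE; apply/negP => /andP[/imsetP[B _ ->]].
by case/orP=> /eqP/setP e; [have := e (inr true)|have := e (inr false)];
  rewrite inE eqxx => /imsetP[].
Qed.

Let t1 := tperm (inl d0 : D) (inr true).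
Let t2 := tperm (inr true : D) (inr false).
Let rot' := (lf (rot S) * t1)%g.
Let opp' := (lf (opp S) * t2)%g.

Let oppl d : opp' (inl d) = inl (opp S d).
Proof. by rewrite permM lfE tpermD. Qed.
Let oppr b : opp' (inr b) = inr (~~ b).
Proof. by rewrite permM lfE'; case: b; rewrite ?tpermL ?tpermR. Qed.
Let rotl d : rot' (inl d) = if rot S d == d0 then inr true else inl (rot S d).
Proof.
rewrite permM lfE; case: eqP => [->|/eqP ne]; first by rewrite tpermL.
by rewrite tpermD // eq_sym.
Qed.
Let rotr b : rot' (inr b) = if b then inl d0 else inr false.
Proof. by rewrite permM lfE'; case: b; rewrite ?tpermR // tpermD. Qed.

Let opp'K : involutive opp'.
Proof. by case=> [d|b]; rewrite ?oppl ?oppr ?oppl ?oppr ?oppK ?negbK. Qed.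
Let opp'_neq d : opp' d != d.
Proof. by case: d => [d|[]]; rewrite ?oppr ?oppl //; have := opp_neq d; apply: contraNneq => -[->]. Qed.

Let inv (A : Type) (F : D -> A) : (forall z, F (rot' z) = F z) ->
  forall z, F (inl (rot S z)) = F (inl z).
Proof.
move=> Fr z; rewrite -(Fr (inl z)) rotl; case: eqP => // ->.
by rewrite -(Fr (inr true)) rotr.
Qed.

Let conn : [transitive <<[set rot'; opp']>>%g, on [set: D] | 'P].
Proof.
pose c := component rot' opp'.
have cr z : c (rot' z) = c z by exact: component_l.
have co z : c (opp' z) = c z by exact: component_r.
have cl d : c (inl d) = c (inl d0).
  apply: (@component_invariant _ _ (c \o inl)) (component_surface d d0) => z /=.
    exact: inv.
  by rewrite -oppl.
have ct : c (inr true) = c (inl d0) by rewrite -cr rotr.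
apply: (@transitive_component _ _ _ (inl d0)) => -[d|[]]; [exact: cl|exact: ct|].
by rewrite -/(c _) -co oppr.
Qed.

Definition leaf_surface := Surface opp'K opp'_neq conn.

Lemma leaf_genus g : has_genus S g -> has_genus leaf_surface g.
Proof.
rewrite /has_genus /euler_char /=.
have pr s b : porbit (lf s) (inr b) = [set inr b] by apply: porbit_fixed.
have e1 : #|porbits rot'| = #|porbits (rot S)|.+1.
  have := porbits_mul_tperm (lf (rot S)) (inl d0) (inr true).
  by rewrite pr inE /= porbitsC -/rot' card_lf !addn2 ?addn1 => -[].
have e2 : #|porbits opp'| = #|porbits (opp S)|.+1.
  have := porbits_mul_tperm (lf (opp S)) (inr true) (inr false).
  by rewrite pr inE /= porbitsC -/opp' card_lf !addn2 ?addn1 => -[].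
have e3 : #|porbits (opp' * rot')%g| = #|porbits (opp S * rot S)%g|.
  (* Before the insertion of the new edge at [d0], the two new darts form one extra cycle beside the
     old faces; the transposition [t1] merges it into a face of [S], so the number of faces is
     restored. *)
  pose s := (opp' * lf (rot S))%g.
  have es : #|porbits s| = #|porbits (opp S * rot S)%g|.+1.
    rewrite /s porbitsC /opp' mulgA -lfM (porbitsC _ t2) (porbitsC (opp S)).
    have := porbits_mul_tperm (lf (rot S * opp S)%g) (inr true) (inr false).
    by rewrite pr inE /= card_lf -/t2 !addn2 ?addn1 => -[].
  have := porbits_mul_tperm s (inl d0) (inr true).
  have -> : (inl d0 : D) \notin porbit s (inr true).
    apply/negP => h; pose isl (z : D) := if z is inl _ then true else false.
    suff inv_isl z : isl (s z) = isl z by have := porbit_invariant inv_isl h.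
    by case: z => [d|b]; rewrite permM ?oppl ?oppr ?lfE ?lfE'.
  by rewrite /= porbitsC /s -mulgA -/rot' es !addn2 ?addn1 => -[].
by rewrite e1 e2 e3; move: #|porbits (rot S)| #|porbits (opp S)| #|porbits (opp S * rot S)%g| => *; lia.
Qed.

Lemma leaf_porbit x y : x \in porbit (rot S) y ->
  (inl x : dart leaf_surface) \in porbit (rot leaf_surface) (inl y).
Proof.
move=> xy; rewrite -eq_porbit_mem; apply/eqP.
apply: (porbit_invariant (F := fun z => porbit rot' (inl z))) xy.
by apply: inv => z; exact: porbit_succ.
Qed.

Lemma leaf_new : (inr true : dart leaf_surface) \in porbit (rot leaf_surface) (inl d0).
Proof. by rewrite porbit_sym -porbit_succ /= rotr porbit_id. Qed.

Lemma leaf_opp : opp leaf_surface (inr true) = inr false /\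
  opp leaf_surface (inr false) = inr true /\
  forall d, opp leaf_surface (inl d) = inl (opp S d).
Proof. by rewrite /= !oppr. Qed.

Lemma leaf_separated x y : (inl x : dart leaf_surface) \in porbit (rot leaf_surface) (inl y) ->
  x \in porbit (rot S) y.
Proof.
pose I (z : D) := match z with inl d => porbit (rot S) d | inr _ => porbit (rot S) d0 end.
move=> h; rewrite -eq_porbit_mem; apply/eqP.
have := @porbit_invariant _ _ I _ _ _ _ h; apply=> -[z|b] /=; last by rewrite rotr; case: b.
by rewrite rotl; case: eqP => [e|_] /=; rewrite -?e porbit_succ.
Qed.

Lemma leaf_porbit_new z : z \in porbit (rot leaf_surface) (inr false) -> z = inr false.
Proof. by rewrite porbit_fixed ?inE => [/eqP|]; rewrite //= rotr. Qed.

End Leaf.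

(** The new edge is drawn from [u] whether or not [v] is adjacent to it, since a 1-skeleton may
    contain edges that the graph does not use. *)
Lemma drawn_leaf k n (G : sgraph n) (A : {set 'I_n}) u v : u \in A -> v \notin A ->
    {in A, forall x, adj G v x -> x = u} ->
  drawn k G A -> drawn k G (v |: A).
Proof.
move=> uA vA vu [S [g [gk Sg [f [f1 f2]]]]].
exists (leaf_surface (f u)), g; split=> //; first exact: leaf_genus.
exists (fun x => if x == v then inr false else inl (f x)).
have [o1 [o2 o3]] := leaf_opp (f u).
have nv x : x \in A -> (x == v) = false by move=> xA; apply: contraNF vA => /eqP <-.
split=> x y /setU1P[->|xA] /setU1P[->|yA]; rewrite ?eqxx ?adj_irr ?(nv _ xA) ?(nv _ yA) //.
- by rewrite porbit_sym => /leaf_porbit_new.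
- by move/leaf_porbit_new.
- by move/leaf_separated; apply: f1.
- move=> /(vu _ yA) ->.
  by exists (inr false); rewrite porbit_id o2; split=> //; apply: leaf_new.
- rewrite adj_sym => /(vu _ xA) ->.
  by exists (inr true); rewrite o1 porbit_id; split=> //; apply: leaf_new.
- move=> /f2[] // d [h1 h2]; exists (inl d).
  by rewrite o3; split; apply: leaf_porbit.
Qed.

(** * Growth of the class *)

Definition graph_of_set n (e : rel 'I_n) : {set 'I_n * 'I_n} :=
  [set p | (p.1 != p.2) && (e p.1 p.2 || e p.2 p.1)].

Lemma graph_of_simple n (e : rel 'I_n) : simple_edges (graph_of_set e).
Proof.
apply/andP; split; apply/forallP=> x; first by rewrite inE eqxx.
by apply/forallP=> y; rewrite !inE /= [y == x]eq_sym orbC.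
Qed.

Definition graph_of n (e : rel 'I_n) := SGraph (graph_of_simple e).

Lemma adj_graph_of n (e : rel 'I_n) x y :
  adj (graph_of e) x y = (x != y) && (e x y || e y x).
Proof. by rewrite /adj inE. Qed.

Lemma sgraph_eq n (G H : sgraph n) : (forall x y, adj G x y = adj H x y) -> G = H.
Proof. by move=> e; apply/val_inj/setP => -[x y]; apply: e. Qed.

Definition nbr n (G : sgraph n) x := [set y | adj G x y].

Lemma card_arcs_from n (G : sgraph n) (X : {set 'I_n}) :
  #|[set p in arcs G | p.1 \in X]| = (\sum_(x in X) #|nbr G x|)%N.
Proof.
under eq_bigr do rewrite -sum1_card.
rewrite pair_big_dep /= -sum1_card; apply: eq_bigl => -[x y].
by rewrite !inE andbC.
Qed.

Lemma card_gt1_other (T : finType) (A : {set T}) x : (1 < #|A|)%N -> exists2 y, y != x & y \in A.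
Proof.
case/card_gt1P=> y [z [yA zA yz]]; have [yx|yx] := eqVneq y x; last by exists y.
by exists z; rewrite // -yx eq_sym.
Qed.

Section GenusClass.
Variable k : nat.
Local Notation C := (genus_class k).

Lemma genus_class_morph n m (G : sgraph n) (H : sgraph m) (h : 'I_m -> 'I_n) :
    injective h -> (forall x y, adj H x y -> adj G (h x) (h y)) ->
  G \in C n -> H \in C m.
Proof.
move=> hI hG /genus_class_drawn Gd; apply/genus_class_drawn.
apply: drawn_morph Gd; [by move=> x y _ _; apply: hI|by move=> x _; rewrite inE|].
by move=> x y _ _; apply: hG.
Qed.

Lemma genus_class_euler m n (G : sgraph n) (V : {set 'I_n}) : G \in C n ->
    (forall x y, adj G x y -> x \in V) ->
    (forall x y, adj G x y -> (1 < #|nbr G x|) || (1 < #|nbr G y|)) ->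
    m = 3 \/ m = 4 /\ (forall x y w, adj G x y -> adj G y w -> adj G w x -> False) ->
  (m * #|arcs G| <= 2 * m * #|V| + 2 * #|arcs G| + 4 * m * k)%N.
Proof.
rewrite inE => /asboolP[g gk [[S [Sg GS]] _]] hV h2 hm.
suff : (m * #|arcs G| <= 2 * m * #|V| + 2 * #|arcs G| + 4 * m * g)%N.
  by move/leq_trans; apply; rewrite leq_add2l leq_mul2l gk orbT.
apply: euler_bound Sg GS _ _ _ hV hm => x y /h2/orP[] h; [right|left].
  by have [w wy] := card_gt1_other y h; rewrite inE; exists w.
by have [w wx] := card_gt1_other x h; rewrite inE; exists w.
Qed.

(** Edges both of whose ends have degree at most 1 violate the hypothesis of the Euler bound. [H]
    omits them and has at most [6 * n + 12 * k] arcs; the omitted arcs start at vertices of degree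
    at most 1, which costs at most [n] more. *)
Lemma card_arcs_le n (G : sgraph n) : G \in C n -> (#|arcs G| <= 7 * n + 12 * k)%N.
Proof.
move=> GC; pose H := graph_of (fun x y => adj G x y && (1 < #|nbr G x|)%N).
have HG x y : adj H x y = adj G x y && ((1 < #|nbr G x|) || (1 < #|nbr G y|))%N.
  rewrite adj_graph_of (adj_sym G y) -andb_orr.
  by case: (boolP (adj G x y)) => [/adj_neq ->|]; rewrite ?andbF.
have HC : H \in C n.
  by apply: (@genus_class_morph _ _ G H id) GC => // x y; rewrite HG => /andP[].
have nH x : (1 < #|nbr G x|)%N -> nbr H x = nbr G x.
  by move=> h; apply/setP=> y; rewrite !inE HG h andbT.
have := @genus_class_euler 3 _ _ [set: 'I_n] HC; rewrite cardsT card_ord => leH.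
have {leH} : (#|arcs H| <= 6 * n + 12 * k)%N.
  suff : (3 * #|arcs H| <= 2 * 3 * n + 2 * #|arcs H| + 4 * 3 * k)%N by lia.
  apply: leH; [by move=> x; rewrite inE| | by left].
  by move=> x y; rewrite HG => /andP[_ /orP[] h]; rewrite (nH _ h) h ?orbT.
have sub : arcs G \subset arcs H :|: [set p in arcs G | p.1 \in [set x | (#|nbr G x| <= 1)%N]].
  apply/subsetP=> -[x y] xy; rewrite in_setU -[_ \in arcs H]/(adj H x y) HG.
  rewrite /adj xy /= in_set xy in_set /=.
  by case: (ltnP 1 #|nbr G x|) => _; rewrite ?orbT.
have := subset_leq_card sub.
have : (#|[set p in arcs G | p.1 \in [set x | (#|nbr G x| <= 1)%N]]| <= n)%N.
  rewrite card_arcs_from; apply: leq_trans (_ : \sum_(x in [set x | (#|nbr G x| <= 1)%N]) 1 <= n)%N.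
    by apply: leq_sum => x; rewrite inE.
  by rewrite sum1_card -[X in (_ <= X)%N]card_ord max_card.
have := cardsU (arcs H) [set p in arcs G | p.1 \in [set x | (#|nbr G x| <= 1)%N]].
lia.
Qed.

(* [3 |S| <= e(S, L) <= 2 (|S| + |L|) + 4 k], by the Euler bound for the bipartite graph
   between [S] and [L]. *)
Lemma card_low_with_high_neighbours n (G : sgraph n) (L S : {set 'I_n}) : G \in C n ->
    [disjoint S & L] -> {in S, forall x, (2 < #|nbr G x|)%N} ->
    {in S, forall x, nbr G x \subset L} ->
  (#|S| <= 2 * #|L| + 4 * k)%N.
Proof.
move=> GC dSL S3 SL; pose H := graph_of (fun x y => (x \in S) && adj G x y).
have HG x y : adj H x y = adj G x y && ((x \in S) || (y \in S)).
  rewrite adj_graph_of (adj_sym G y) -andb_orl andbC.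
  by case: (boolP (adj G x y)) => [/adj_neq ->|]; rewrite ?andbF ?andbT.
have HC : H \in C n.
  by apply: (@genus_class_morph _ _ G H id) GC => // x y; rewrite HG => /andP[].
have nH x : x \in S -> nbr H x = nbr G x.
  by move=> h; apply/setP=> y; rewrite !inE HG h andbT.
have toL x y : x \in S -> adj G x y -> y \in L.
  by move=> xS xy; apply: (subsetP (SL _ xS)); rewrite inE.
have nSL x : x \in S -> x \in L -> False by move=> xS; rewrite (disjointFr dSL xS).
have := @genus_class_euler 4 _ _ (S :|: L) HC.
have -> : (#|S :|: L| = #|S| + #|L|)%N.
  by rewrite cardsU; move: dSL; rewrite -setI_eq0 => /eqP ->; rewrite cards0 subn0.
move=> le; have {le} : (4 * #|arcs H| <= 2 * 4 * (#|S| + #|L|) + 2 * #|arcs H| + 4 * 4 * k)%N.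
  apply: le.
  - move=> x y; rewrite HG inE => /andP[xy /orP[->//|yS]].
    by rewrite (toL _ _ yS) ?orbT // adj_sym.
  - move=> x y; rewrite HG => /andP[_ /orP[] h]; apply/orP; [left|right];
      rewrite (nH _ h); exact: ltnW (S3 _ h).
  right; split=> // x y w; rewrite !HG => /andP[xy h1] /andP[yw h2] /andP[wx h3].
  have [yx [wy xw]] : adj G y x /\ adj G w y /\ adj G x w by rewrite (adj_sym G y) (adj_sym G w) (adj_sym G x w).
  by case/orP: h1 => [xS|yS]; case/orP: h2 => [yS'|wS]; case/orP: h3 => [wS'|xS'];
    eauto using toL, nSL.
have sub : [set p in arcs H | p.1 \in S] :|: [set (p.2, p.1) | p in [set p in arcs H | p.1 \in S]]
    \subset arcs H.
  apply/subsetP=> p /setUP[|/imsetP[[x y]]]; first by rewrite inE => /andP[].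
  by rewrite inE => /andP[xy _] ->; rewrite -/(adj H _ _) adj_sym.
have := subset_leq_card sub; rewrite cardsU.
rewrite [_ :&: _](_ : _ = set0); last first.
  apply/setP=> -[x y]; rewrite in_setI in_set0; apply/negP => /andP[].
  rewrite in_set => /andP[xy xS] /imsetP[[u v]]; rewrite in_set /= => /andP[uv uS] [e1 e2]; subst u v.
  by apply: (nSL y) => //; apply: (toL x) => //; have := HG x y; rewrite {1}/adj xy => /esym/andP[].
rewrite cards0 subn0 card_imset; last by move=> [x y] [u v] [-> ->].
have : (3 * #|S| <= #|[set p in arcs H | p.1 \in S]|)%N.
  rewrite card_arcs_from mulnC -sum_nat_const; apply: leq_sum => x xS.
  by rewrite nH // S3.
by move=> h1 h2; have := leq_trans (leq_add h1 h1) h2; lia.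
Qed.

End GenusClass.

(** Here [R a b] reads: [b] is a code from which [a] can be recovered. A relation instead of a
    function lets the choices in a code, such as a neighbour, stay existential. *)
Lemma card_le_rel (A B : finType) (P : {set A}) (Q : {set B}) (R : A -> B -> Prop) :
    {in P, forall a, exists2 b, b \in Q & R a b} ->
    {in P &, forall a a' b, R a b -> R a' b -> a = a'} ->
  (#|P| <= #|Q|)%N.
Proof.
move=> PQ RI; pose f a := [pick b in Q | `[< R a b >]].
have fP a : a \in P -> exists b, [/\ b \in Q, R a b & f a = Some b].
  move=> aP; rewrite /f; case: pickP => [b /andP[bQ /asboolP ab]|no]; first by exists b.
  by have [b bQ ab] := PQ _ aP; have := no b; rewrite bQ /=; move/asboolP: ab => ->.
have sI : injective (@Some B) by move=> u v [].
have fI : {in P &, injective f}.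
  move=> a a' aP a'P; have [b [_ ab ->]] := fP _ aP; have [b' [_ ab' ->]] := fP _ a'P.
  by move=> [e]; apply: (RI _ _ aP a'P b') => //; rewrite -e.
rewrite -(card_in_imset fI) -(card_imset _ sI); apply/subset_leq_card/subsetP.
by move=> _ /imsetP[a aP ->]; have [b [bQ _ ->]] := fP _ aP; apply: imset_f.
Qed.

Lemma card_pairs_le (A B : finType) (X : {set A}) (Q : A -> {set B}) m :
    {in X, forall a, (#|Q a| <= m)%N} ->
  (#|[set p : A * B | (p.1 \in X) && (p.2 \in Q p.1)]| <= #|X| * m)%N.
Proof.
move=> h; rewrite -sum_nat_const; apply: leq_trans (leq_sum _ h).
under eq_bigr do rewrite -sum1_card.
rewrite pair_big_dep /= -sum1_card; apply: eq_leq; apply: eq_bigl => -[x y].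
by rewrite !inE.
Qed.

Lemma porbit_trans (T : finType) (s : {perm T}) x y z :
  x \in porbit s y -> y \in porbit s z -> x \in porbit s z.
Proof. by rewrite -!eq_porbit_mem => /eqP ->. Qed.

Lemma adj_nbr n (G : sgraph n) x y A : nbr G x = A -> adj G x y = (y \in A).
Proof. by move=> <-; rewrite inE. Qed.

(** * Reconstruction of a graph from a deletion or a contraction *)

Section Reductions.
Variable n : nat.
Implicit Types (G : sgraph n.+1) (v : 'I_n.+1) (u : 'I_n).

Definition delete_vertex G v : sgraph n :=
  graph_of (fun x y => adj G (lift v x) (lift v y)).

(* The contraction of the edge between [v] and [lift v u]. *)
Definition contract G v u : sgraph n :=
  graph_of (fun x y => adj G (lift v x) (lift v y) || (x == u) && adj G v (lift v y)).

Lemma adj_delete G v x y : adj (delete_vertex G v) x y = adj G (lift v x) (lift v y).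
Proof.
rewrite adj_graph_of (adj_sym G (lift v y)) orbb andbC.
by case: (boolP (adj _ _ _)) => // /adj_neq; rewrite (inj_eq lift_inj) => ->.
Qed.

Lemma adj_contract G v u x y : adj (contract G v u) x y = (x != y) &&
  [|| adj G (lift v x) (lift v y), (x == u) && adj G v (lift v y) | (y == u) && adj G v (lift v x)].
Proof.
by rewrite adj_graph_of (adj_sym G (lift v y)); case: (x == y); case: (adj G (lift v x) _).
Qed.

Lemma sgraph_eq_lift G H v :
    (forall x y, adj G (lift v x) (lift v y) = adj H (lift v x) (lift v y)) ->
    (forall y, adj G v (lift v y) = adj H v (lift v y)) -> G = H.
Proof.
move=> h1 h2; apply: sgraph_eq => x y.
case: (unliftP v x) => [x'|] ->; case: (unliftP v y) => [y'|] ->; rewrite ?adj_irr //.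
by rewrite !(adj_sym _ (lift v x')).
Qed.

Variable k : nat.
Local Notation C := (genus_class k).

Lemma genus_class_delete G v : G \in C n.+1 -> delete_vertex G v \in C n.
Proof.
apply: (@genus_class_morph k _ _ _ _ (lift v)); first exact: lift_inj.
by move=> x y; rewrite adj_delete.
Qed.

Lemma genus_class_contract G v u : G \in C n.+1 -> adj G v (lift v u) -> contract G v u \in C n.
Proof.
move=> /genus_class_drawn[S [g [gk Sg [f [f1 f2]]]]] vu; apply/genus_class_drawn.
have {}f1 x y : f x \in porbit (rot S) (f y) -> x = y by apply: f1; rewrite inE.
have {}f2 x y : adj G x y -> exists d,
  d \in porbit (rot S) (f x) /\ opp S d \in porbit (rot S) (f y) by apply: f2; rewrite inE.
have [d [du dv]] : exists d,
  d \in porbit (rot S) (f (lift v u)) /\ opp S d \in porbit (rot S) (f v).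
  by apply: f2; rewrite adj_sym.
have nloop : opp S d \notin porbit (rot S) d.
  apply/negP => h; have /negP[] := neq_lift v u; apply/eqP/f1.
  by apply: porbit_trans du; apply: porbit_trans h; rewrite porbit_sym.
have nv x : f (lift v x) \notin porbit (rot S) (opp S d).
  apply/negP => h; have /negP[] := neq_lift v x; apply/eqP/f1.
  by rewrite porbit_sym; apply: porbit_trans h dv.
exists (contract_surface nloop), g; split=> //; first exact: contract_genus.
exists (fun x => f (lift v x)); split=> x y _ _.
  by move=> h; apply/(@lift_inj _ v)/f1/(contract_separated nloop h).
have joined z d' : z = u -> d' \in porbit (rot S) (f v) ->
    d' \in porbit (rot (contract_surface nloop)) (f (lift v z)).
  move=> -> d'v; rewrite porbit_sym; apply: (contract_joined nloop); first by rewrite porbit_sym.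
  by apply: porbit_trans d'v _; rewrite porbit_sym.
rewrite adj_contract => /andP[_ /or3P[/f2|/andP[/eqP xu /f2]|/andP[/eqP yu /f2]]] [d' [h1 h2]].
- by exists d'; split; apply: (contract_porbit nloop).
- by exists d'; split; [apply: joined | apply: (contract_porbit nloop)].
- by exists (opp S d'); rewrite /= oppK; split; [apply: (contract_porbit nloop) | apply: joined].
Qed.

Lemma card_deg0 :
  (#|[set p : sgraph n.+1 * 'I_n.+1 | (p.1 \in C n.+1) && (nbr p.1 p.2 == set0)]| <= n.+1 * #|C n|)%N.
Proof.
rewrite -[X in (X * _)%N]card_ord -cardsT -cardsX.
apply: (@card_le_rel _ _ _ _ (fun p q => p.2 = q.1 /\ delete_vertex p.1 p.2 = q.2)).
  case=> G v; rewrite in_set => /andP[GC _]; exists (v, delete_vertex G v) => //.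
  by rewrite !in_setX !in_setT genus_class_delete.
move=> [G v] [G' v']; rewrite !in_set /= => /andP[_ /eqP n1] /andP[_ /eqP n2] [_ H] /= [<- e1] [e e2]; subst v'.
congr pair; apply: (@sgraph_eq_lift _ _ v) => [x y|y].
  by rewrite -!adj_delete e1 e2.
by rewrite (adj_nbr _ n1) (adj_nbr _ n2).
Qed.

Lemma card_deg1 :
  (#|[set p : sgraph n.+1 * 'I_n.+1 | (p.1 \in C n.+1) && (#|nbr p.1 p.2| == 1)]|
   <= n.+1 * #|C n| * n)%N.
Proof.
rewrite -[X in (X * _ * _)%N]card_ord -cardsT -cardsX -[X in (_ <= _ * X)%N]card_ord -cardsT -cardsX.
apply: (@card_le_rel _ _ _ _ (fun p q =>
  [/\ p.2 = q.1.1, delete_vertex p.1 p.2 = q.1.2 & nbr p.1 p.2 = [set lift p.2 q.2]])).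
  case=> G v; rewrite in_set /= => /andP[GC /cards1P[w nw]].
  have : adj G v w by have := set11 w; rewrite -nw inE.
  case: (unliftP v w) => [u wu _|->]; last by rewrite adj_irr.
  exists (v, delete_vertex G v, u); last by rewrite /= nw wu.
  by rewrite !in_setX !in_setT genus_class_delete.
move=> [G v] [G' v'] _ _ [[_ H] u] /= [<- e1 n1] [e e2 n2]; subst v'.
congr pair; apply: (@sgraph_eq_lift _ _ v) => [x y|y].
  by rewrite -!adj_delete e1 e2.
by rewrite (adj_nbr _ n1) (adj_nbr _ n2).
Qed.

(** Deleting the vertex would leave about [n ^ 2] choices for its two neighbours. Contracting it
    into one of them makes them adjacent, so the pair is one of the O(n) arcs of the smaller graph;
    one bit records whether they were adjacent before. *)
Lemma card_deg2 :
  (#|[set p : sgraph n.+1 * 'I_n.+1 | (p.1 \in C n.+1) && (#|nbr p.1 p.2| == 2)]|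
   <= n.+1 * #|C n| * (2 * (7 * n + 12 * k)))%N.
Proof.
rewrite -[X in (X * _ * _)%N]card_ord -cardsT -cardsX.
pose Q (p : 'I_n.+1 * sgraph n) := setX [set: bool] (arcs p.2).
apply: leq_trans (@card_pairs_le _ _ _ Q _ _); last first.
  move=> [v H]; rewrite inE => /andP[_ HC]; rewrite cardsX cardsT card_bool leq_mul2l.
  exact: card_arcs_le.
apply: (@card_le_rel _ _ _ _ (fun p q =>
  [/\ p.2 = q.1.1, contract p.1 p.2 q.2.2.1 = q.1.2,
      nbr p.1 p.2 = [set lift p.2 q.2.2.1; lift p.2 q.2.2.2] &
      adj p.1 (lift p.2 q.2.2.1) (lift p.2 q.2.2.2) = q.2.1])).
  case=> G v; rewrite in_set /= => /andP[GC /cards2P[x [y [xy nxy]]]].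
  have : adj G v x by have := set21 x y; rewrite -nxy inE.
  case: (unliftP v x) => [u xu vx|->]; last by rewrite adj_irr.
  have : adj G v y by have := set22 x y; rewrite -nxy inE.
  case: (unliftP v y) => [w yw vy|->]; last by rewrite adj_irr.
  exists ((v, contract G v u), (adj G x y, (u, w))); last by rewrite /= nxy xu yw.
  rewrite in_set /Q !in_setX !in_setT genus_class_contract -?xu //=.
  have : adj (contract G v u) u w; last by [].
  rewrite adj_contract eqxx -yw vy orbT andbT.
  by apply: contraNneq xy => e; rewrite xu yw e.
move=> [G v] [G' v'] _ _ [[_ H] [b [u w]]] /= [<- e1 n1 b1] [e e2 n2 b2]; subst v'.
have nE y : (adj G v (lift v y) = (y == u) || (y == w)) /\ (adj G' v (lift v y) = (y == u) || (y == w)).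
  by rewrite (adj_nbr _ n1) (adj_nbr _ n2) !inE !(inj_eq lift_inj).
congr pair; apply: (@sgraph_eq_lift _ _ v) => [x y|y]; last by have [-> ->] := nE y.
have [->|xy] := eqVneq x y; first by rewrite !adj_irr.
have := adj_contract G v u x y; have := adj_contract G' v u x y.
rewrite e1 e2 xy /= => ->; have [-> ->] := nE x; have [-> ->] := nE y.
have [xu|xu] := eqVneq x u; have [yu|yu] := eqVneq y u; have [xw|xw] := eqVneq x w; have [yw|yw] := eqVneq y w;
  rewrite ?orbF ?orbT //=; subst; rewrite ?eqxx in xy * => //; rewrite ?b1 ?b2 // !(adj_sym _ (lift v w)) ?b1 ?b2 //.
Qed.

(** After contracting [v] into its neighbour, the merged vertex [u] has degree at most [2 * m]. Its
    old neighbours and those of [v] are two subsets [B] and [A] of its neighbourhood, so besides [u]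
    only boundedly many choices remain. *)
Lemma card_low_neighbour (m : nat) :
  (#|[set p : sgraph n.+1 * 'I_n.+1 | (p.1 \in C n.+1) &&
      ((#|nbr p.1 p.2| <= m) && [exists w, adj p.1 p.2 w && (#|nbr p.1 w| <= m)])]|
   <= n.+1 * #|C n| * (n * (2 ^ (2 * m)) ^ 2))%N.
Proof.
rewrite -[X in (X * _ * _)%N]card_ord -cardsT -cardsX.
pose Q (p : 'I_n.+1 * sgraph n) : {set 'I_n * ({set 'I_n} * {set 'I_n})} :=
  [set q | (q.1 \in [set u | (#|nbr p.2 u| <= 2 * m)%N]) &&
           (q.2 \in setX (powerset (nbr p.2 q.1)) (powerset (nbr p.2 q.1)))].
apply: leq_trans (@card_pairs_le _ _ _ Q _ _); last first.
  move=> [v H] _; pose Q2 u := setX (powerset (nbr H u)) (powerset (nbr H u)).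
  apply: leq_trans (@card_pairs_le _ _ _ Q2 ((2 ^ (2 * m)) ^ 2) _) _.
    move=> u; rewrite in_set => hu; rewrite /Q2 cardsX card_powerset -mulnn.
    by rewrite leq_mul // leq_exp2l.
  by rewrite leq_mul2r (leq_trans (max_card _)) ?orbT // card_ord.
apply: (@card_le_rel _ _ _ _ (fun p q =>
  [/\ p.2 = q.1.1, contract p.1 p.2 q.2.1 = q.1.2, adj p.1 p.2 (lift p.2 q.2.1),
      q.2.2.1 = [set x | (x != q.2.1) && adj p.1 p.2 (lift p.2 x)] &
      q.2.2.2 = [set x | adj p.1 (lift p.2 q.2.1) (lift p.2 x)]])).
  case=> G v; rewrite in_set /= => /andP[GC /andP[vm /existsP[w /andP[+ wm]]]].
  case: (unliftP v w) wm => [u ->|->]; last by rewrite adj_irr.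
  move=> um vu; pose A := [set x | (x != u) && adj G v (lift v x)].
  pose B := [set x | adj G (lift v u) (lift v x)].
  exists ((v, contract G v u), (u, (A, B))); last by [].
  rewrite in_set in_setX in_setT genus_class_contract //= in_set !in_setX !powersetE in_set /=.
  have nH : nbr (contract G v u) u = A :|: B.
    apply/setP=> x; rewrite in_setU !in_set adj_contract eqxx /= (eq_sym u).
    have [->|xu] := eqVneq x u; first by rewrite adj_irr.
    by rewrite /= orbF orbC.
  rewrite nH finset.subsetUl finset.subsetUr !andbT mul2n -addnn.
  apply: leq_trans (_ : #|A| + #|B| <= _)%N; first by rewrite cardsU leq_subr.
  apply: leq_add.
    apply: leq_trans vm; rewrite -(card_imset _ (@lift_inj _ v)); apply/subset_leq_card/subsetP.
    by move=> _ /imsetP[x + ->]; rewrite !in_set => /andP[].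
  apply: leq_trans um; rewrite -(card_imset _ (@lift_inj _ v)); apply/subset_leq_card/subsetP.
  by move=> _ /imsetP[x + ->]; rewrite !in_set.
move=> [G v] [G' v'] _ _ [[_ H] [u [A B]]] /= [<- e1 vu eA eB] [e e2 vu' eA' eB']; subst v'.
have nA y : adj G v (lift v y) = adj G' v (lift v y).
  have [->|yu] := eqVneq y u; first by rewrite vu vu'.
  have : (y \in A) = adj G v (lift v y) by rewrite eA in_set yu.
  by rewrite eA' in_set yu.
have nB y : adj G (lift v u) (lift v y) = adj G' (lift v u) (lift v y).
  have : (y \in B) = adj G (lift v u) (lift v y) by rewrite eB in_set.
  by rewrite eB' in_set.
congr pair; apply: (@sgraph_eq_lift _ _ v) => // x y.
have [->|xu] := eqVneq x u; first exact: nB.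
have [->|yu] := eqVneq y u; first by rewrite !(adj_sym _ (lift v x)) nB.
have [->|xy] := eqVneq x y; first by rewrite !adj_irr.
have := adj_contract G v u x y; have := adj_contract G' v u x y.
by rewrite e1 e2 xy (negPf xu) (negPf yu) /= !orbF => ->.
Qed.

End Reductions.

Section Growth.
Variable k : nat.
Local Notation C := (genus_class k).

Definition reducible n (G : sgraph n) m v :=
  (#|nbr G v| <= 2)%N || (#|nbr G v| <= m)%N && [exists w, adj G v w && (#|nbr G w| <= m)%N].

(** A vertex that is not reducible lies in [L] or in [S], and together these have at most
    [3 * #|L| + 4 * k] elements. As [72 * #|L|] is at most [7 * n + 12 * k], this is at most
    [7 n / 24 + 9 k / 2], which is below [n / 2] once [n >= 22 * k]. *)
Lemma card_reducible n (G : sgraph n) : G \in C n -> (22 * k <= n)%N ->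
  (n <= 2 * #|[set v | reducible G 71 v]|)%N.
Proof.
move=> GC kn; have := card_arcs_le GC.
pose L := [set v | (71 < #|nbr G v|)%N].
pose S := [set v | (2 < #|nbr G v| <= 71)%N && (nbr G v \subset L)].
have cS : (#|S| <= 2 * #|L| + 4 * k)%N.
  apply: card_low_with_high_neighbours GC _ _ _.
  - rewrite disjoints_subset; apply/subsetP=> v; rewrite !inE -leqNgt.
    by case/andP=> /andP[].
  - by move=> v; rewrite inE => /andP[/andP[]].
  - by move=> v; rewrite inE => /andP[].
have cL : (72 * #|L| <= #|arcs G|)%N.
  apply: leq_trans (subset_leq_card (_ : [set p in arcs G | p.1 \in L] \subset _)).
    rewrite card_arcs_from mulnC -sum_nat_const; apply: leq_sum => v.
    by rewrite inE.
  by apply/subsetP=> p; rewrite inE => /andP[].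
have cov : [set: 'I_n] \subset [set v | reducible G 71 v] :|: (L :|: S).
  apply/subsetP=> v _; rewrite in_setU in_set; case: (boolP (reducible _ _ _)) => //=.
  rewrite /reducible negb_or -ltnNge => /andP[v2]; rewrite !inE v2 /=.
  case: (ltnP 71 #|nbr G v|) => //= vm /existsPn h.
  by apply/subsetP=> w; rewrite !inE => vw; have := h w; rewrite vw -ltnNge.
have := subset_leq_card cov; rewrite cardsT card_ord.
have : (#|[set v | reducible G 71 v] :|: (L :|: S)| <= #|[set v | reducible G 71 v]| + (#|L| + #|S|))%N.
  apply: leq_trans (_ : _ <= #|[set v | reducible G 71 v]| + #|L :|: S|)%N _.
    by rewrite cardsU leq_subr.
  by rewrite leq_add2l cardsU leq_subr.
move: cS cL; move: #|arcs G| #|L| #|S| #|_ :|: _| #|[set v | reducible G 71 v]| => a l s u r; lia.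
Qed.

(** Pairs of a graph and a reducible vertex are counted twice: at least [n.+1 / 2] per graph, and by
    the four reconstruction bounds at most O(n) per position of the vertex and per smaller graph. *)
Lemma genus_class_growth : exists K, forall n, (22 * k <= n.+1)%N ->
  (#|C n.+1| <= K * n.+1 * #|C n|)%N.
Proof.
(* Keeps 71 opaque, so that the powers of 2 below are never evaluated. *)
have [m hm] : exists m, m = 71 by exists 71.
(* The 16 collects 1 for degree 0, 1 for degree 1 and 14 for degree 2, which also gives [24 * k];
   the power is the low-neighbour case and the outer 2 comes from only half of the vertices being
   reducible. *)
exists (2 * (16 + 24 * k + (2 ^ (2 * m)) ^ 2))%N => n hn.
pose T : finType := (sgraph n.+1 * 'I_n.+1)%type.
pose P0 : {set T} := [set p | (p.1 \in C n.+1) && (nbr p.1 p.2 == set0)].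
pose P1 : {set T} := [set p | (p.1 \in C n.+1) && (#|nbr p.1 p.2| == 1)].
pose P2 : {set T} := [set p | (p.1 \in C n.+1) && (#|nbr p.1 p.2| == 2)].
pose P3 : {set T} := [set p | (p.1 \in C n.+1) &&
  ((#|nbr p.1 p.2| <= m)%N && [exists w, adj p.1 p.2 w && (#|nbr p.1 w| <= m)%N])].
have h0 : (#|P0| <= _)%N := card_deg0 n k.
have h1 : (#|P1| <= _)%N := card_deg1 n k.
have h2 : (#|P2| <= _)%N := card_deg2 n k.
have h3 : (#|P3| <= _)%N := card_low_neighbour n k m.
set X := ((2 ^ (2 * m)) ^ 2)%N in h3 *.
pose P : {set T} := [set p | (p.1 \in C n.+1) && reducible p.1 m p.2].
have cP : (n.+1 * #|C n.+1| <= 2 * #|P|)%N.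
  have -> : #|P| = (\sum_(G in C n.+1) #|[set v | reducible G m v]|)%N.
    under eq_bigr do rewrite -sum1_card.
    rewrite pair_big_dep /= -sum1_card; apply: eq_bigl => -[G v].
    by rewrite [LHS]in_set; congr (_ && _); rewrite in_set.
  rewrite mulnC -sum_nat_const big_distrr /=; apply: leq_sum => G GC.
  by rewrite hm; apply: card_reducible.
have sub : P \subset P0 :|: (P1 :|: (P2 :|: P3)).
  apply/subsetP=> -[G v]; rewrite !in_setU !in_set /= /reducible => /andP[-> /=].
  case/orP=> [|->]; last by rewrite !orbT.
  rewrite -cards_eq0; by case: #|_| => [|[|[|]]] //=; rewrite ?orbT.
have cU : (#|P| <= #|P0| + (#|P1| + (#|P2| + #|P3|)))%N.
  apply: leq_trans (subset_leq_card sub) _.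
  do 3 (rewrite cardsU; apply: leq_trans (leq_subr _ _) _; rewrite leq_add2l).
  exact: leqnn.
have : (n.+1 * #|C n.+1| <= n.+1 * (2 * (16 + 24 * k + X) * n.+1 * #|C n|))%N.
  apply: leq_trans cP _; move: h0 h1 h2 h3 cU.
  move: #|P| #|P0| #|P1| #|P2| #|P3| #|C n| X => p p0 p1 p2 p3 c x; nia.
by rewrite leq_pmul2l.
Qed.

End Growth.

(** * The edge elimination polynomial of a grown tree *)

Section GrownTrees.
Local Open Scope ring_scope.
Variables (R : comNzRingType) (x y z : R) (T : finType).
Local Notation xi := (xi x y z).
Implicit Types (V B : {set T}) (s : seq (T * T)).

Definition delete_at (u : T) s := [seq f <- s | (f.1 != u) && (f.2 != u)].

Lemma wf_edges_delete u V s : wf_edges V s -> wf_edges (V :\ u) (delete_at u s).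
Proof.
move=> /allP wf; apply/allP => f; rewrite mem_filter => /andP[/andP[n1 n2] /wf/andP[f1 f2]].
by rewrite !in_setD1 n1 n2 f1.
Qed.

Lemma wf_edges_sub V B s : {subset V <= B} -> wf_edges V s -> wf_edges B s.
Proof. by move=> sub; apply: sub_all => f /andP[/sub-> /sub->]. Qed.

Lemma xi_isolated v V s : wf_edges V s -> v \notin V -> xi (v |: V) s = x * xi V s.
Proof.
move=> wf vV; rewrite -[s in LHS]cat0s xi_disjoint_union // ?xi_K1 //.
by rewrite disjoints1.
Qed.

(** Deleting the edge isolates [v] and gives the factor [x]; contracting it gives back the graph
    with factor [y]; extracting it removes [u] as well. *)
Lemma xi_leaf u v V s : wf_edges V s -> u \in V -> v \notin V ->
  xi (v |: V) ((u, v) :: s) = (x + y) * xi V s + z * xi (V :\ u) (delete_at u s).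
Proof.
move=> wf uV vV; rewrite xi_cons xi_isolated // mulrDl; congr (_ + _ * _ + _ * _).
- have mV w : w \in V -> merge (u, v) w = w.
    by move=> wV; rewrite /merge /=; case: eqP => // e; rewrite -e wV in vV.
  congr Defs.xi.
    apply/setP=> w; apply/imsetP/idP => [[w' /setU1P[->|w'V] ->]|wV].
    + by rewrite /merge eqxx.
    + by rewrite mV.
    by exists w; rewrite ?in_setU1 ?wV ?orbT // mV.
  rewrite -[RHS]map_id; apply/eq_in_map => -[a b] /(allP wf)/andP[aV bV].
  by rewrite /map_edge !mV.
- have ne w : w \in V -> w != v by move=> wV; apply: contraNneq vV => <-.
  congr Defs.xi.
    apply/setP=> w; rewrite !inE /= negb_or; case: (w =P v) => [->|]; rewrite ?andbF //=.
      by rewrite (negPf vV) andbF.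
    by rewrite andbT.
  apply/eq_in_filter=> -[a b] /(allP wf)/andP[/= /ne aV /ne bV].
  by rewrite /touches !inE /= (negPf aV) (negPf bV) !orbF negb_or.
Qed.

(* A forest grown over a multigraph, latest vertex first: [(Some u, v)] adds the
   vertex [v] as a leaf at [u], and [(None, v)] adds it as an isolated vertex.
   The vertices are named by numbers, [0] being the root in the multigraph. *)
Definition growth := seq (option nat * nat).
Implicit Type l : growth.

Definition grown l : seq nat := map snd l.

(** [rooted] tells whether the root is still present, since nothing may hang from it once it has
    been extracted; [m] bounds the names on which the placement [w] is injective. *)
Fixpoint valid_growth m (rooted : bool) l : bool :=
  if l is (o, v) :: l' then
    [&& valid_growth m rooted l', v \notin grown l', (0 < v < m)%N &
        if o is Some u then (u \in grown l') || (u == 0%N) && rooted else true]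
  else true.

(** When [u] is deleted, its children survive as vertices added without a parent; this is why
    growths allow [None]. *)
Definition prune u l : growth :=
  [seq (if e.1 == Some u then None else e.1, e.2) | e <- l & e.2 != u].

Lemma grown_prune u l : grown (prune u l) = [seq v <- grown l | v != u].
Proof. by rewrite /grown /prune -map_comp filter_map. Qed.

Lemma valid_prune m rooted u l : valid_growth m rooted l ->
  valid_growth m (rooted && (u != 0%N)) (prune u l).
Proof.
elim: l => [|[o v] l IH] //= /and4P[/IH vl nv v0 ho]; rewrite /prune /=.
case: (v =P u) => /= [//|vu]; rewrite -/(prune u l) vl v0 grown_prune mem_filter (negPf nv) andbF /=.
case: o ho => [w|] //=; have [[->]//|/eqP wu] := eqVneq (Some w) (Some u).
have {}wu : w != u by apply: contra_not_neq wu => ->.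
rewrite mem_filter wu /=; case/orP => [->//|/andP[/eqP w0 ->]].
by rewrite w0 in wu *; rewrite eq_sym wu orbT.
Qed.

Variables (m : nat) (w : nat -> T) (V0 : {set T}) (s0 : seq (T * T)).
Hypotheses (w_inj : forall i j, (i < m)%N -> (j < m)%N -> w i = w j -> i = j)
  (w0 : w 0%N \in V0) (w_new : forall i, (0 < i < m)%N -> w i \notin V0)
  (wf0 : wf_edges V0 s0) (m_gt0 : (0 < m)%N).

Fixpoint grown_verts B l : {set T} :=
  if l is (_, v) :: l' then w v |: grown_verts B l' else B.

Fixpoint grown_edges s l : seq (T * T) :=
  if l is (o, v) :: l' then
    (if o is Some u then [:: (w u, w v)] else [::]) ++ grown_edges s l'
  else s.

Definition base_verts (rooted : bool) := if rooted then V0 else V0 :\ w 0%N.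
Definition base_edges (rooted : bool) := if rooted then s0 else delete_at (w 0%N) s0.

(* The coefficients of [a = xi V0 s0] and of [b = xi] of the multigraph without
   its root, by repeated use of the rule for a leaf; [n] is fuel. *)
Fixpoint eval_growth (a b : R) n (rooted : bool) l : R :=
  match n, l with
  | n'.+1, (None, _) :: l' => x * eval_growth a b n' rooted l'
  | n'.+1, (Some u, _) :: l' => (x + y) * eval_growth a b n' rooted l'
      + z * eval_growth a b n' (rooted && (u != 0%N)) (prune u l')
  | _, _ => if rooted then a else b
  end.

Lemma grown_lt rooted l u : valid_growth m rooted l -> u \in grown l -> (0 < u < m)%N.
Proof.
elim: l => [|[o v] l IH] //= /and4P[vl _ v0 _]; rewrite inE => /orP[/eqP->//|]; exact: IH.
Qed.

Lemma grown_vertsP rooted l B t : valid_growth m rooted l ->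
  (t \in grown_verts B l) = (t \in B) || (t \in map w (grown l)).
Proof.
elim: l => [|[o v] l IH] /=; first by rewrite orbF.
by case/and4P=> /IH e _ _ _; rewrite in_setU1 e inE orbCA.
Qed.

Lemma base_vertsP rooted t : t \in base_verts rooted -> t \in V0.
Proof. by case: rooted => //; rewrite inE => /andP[]. Qed.

Lemma w_mem u l rooted : (u < m)%N -> valid_growth m rooted l ->
  (w u \in map w (grown l)) = (u \in grown l).
Proof.
move=> um vl; apply/mapP/idP => [[v vl' e]|]; last by exists u.
by rewrite (w_inj um _ e) //; case/andP: (grown_lt vl vl').
Qed.

Lemma wf_grown rooted l : valid_growth m rooted l ->
  wf_edges (grown_verts (base_verts rooted) l) (grown_edges (base_edges rooted) l).
Proof.
elim: l => [|[o v] l IH] /=; first by case: rooted => //= _; apply: wf_edges_delete.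
case/and4P=> vl nv v0 ho; rewrite /wf_edges all_cat; apply/andP; split; last first.
  by apply: wf_edges_sub (IH vl) => t; rewrite in_setU1 => ->; rewrite orbT.
case: o ho => [u|] //= hu; rewrite !in_setU1 eqxx /= andbT.
rewrite (grown_vertsP _ _ vl); case/orP: hu => [ul|/andP[/eqP -> ->]] /=.
  by rewrite map_f ?orbT.
by rewrite w0 !orbT.
Qed.

Lemma delete_at_grown rooted s l u : (u < m)%N -> valid_growth m rooted l ->
  delete_at (w u) (grown_edges s l) = grown_edges (delete_at (w u) s) (prune u l).
Proof.
move=> um; elim: l => [|[o v] l IH] //= /and4P[vl nv /andP[_ vm] ho].
have weq a : (a < m)%N -> (w a == w u) = (a == u).
  by move=> am; apply/eqP/eqP => [/(w_inj am um)|->].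
rewrite /delete_at filter_cat -!/(delete_at _ _) IH // /prune /=.
have -> : delete_at (w u) (if o is Some a then [:: (w a, w v)] else [::]) =
    if o is Some a then if (a != u) && (v != u) then [:: (w a, w v)] else [::] else [::].
  case: o ho => [a|] //= ha; rewrite !weq //.
  by case/orP: ha => [/(grown_lt vl)/andP[]//|/andP[/eqP-> _]].
case: (v =P u) => [->|_] /=; rewrite -/(prune u l); first by case: o {ho} => [a|] //=; rewrite andbF.
by case: o {ho} => [a|] //=; rewrite andbT (inj_eq (@Some_inj _)); case: eqP.
Qed.

Lemma delete_at_base rooted u : (u < m)%N ->
  delete_at (w u) (base_edges rooted) = base_edges (rooted && (u != 0%N)).
Proof.
move=> um; have [->|u0] := eqVneq u 0%N.
  rewrite andbF /base_edges; case: rooted => //.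
  by rewrite /delete_at -filter_predI; apply: eq_filter => f /=; rewrite andbb.
rewrite andbT; apply/all_filterP/allP => f.
have uV : w u \notin V0 by rewrite w_new // lt0n u0.
have wfV f' : f' \in s0 -> (f'.1 != w u) && (f'.2 != w u).
  move=> /(allP wf0)/andP[f1 f2].
  by apply/andP; split; [apply: contraNneq uV => <-|apply: contraNneq uV => <-].
by rewrite /base_edges; case: rooted => [/wfV//|]; rewrite mem_filter => /andP[_ /wfV].
Qed.

(** Pruning never lengthens a growth, so the length of [l] is enough fuel even though the recursion
    is not structural. *)
Lemma xi_grown n rooted l : (size l <= n)%N -> valid_growth m rooted l ->
  xi (grown_verts (base_verts rooted) l) (grown_edges (base_edges rooted) l) =
  eval_growth (xi V0 s0) (xi (V0 :\ w 0%N) (delete_at (w 0%N) s0)) n rooted l.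
Proof.
elim: n rooted l => [|n IH] rooted [|[o v] l] //= sl; try by case: rooted.
case/and4P=> vl nv vm ho.
have vV : w v \notin grown_verts (base_verts rooted) l.
  rewrite (grown_vertsP _ _ vl) (w_mem _ vl); last by case/andP: vm.
  by rewrite (negPf nv) orbF; apply: contra (w_new vm); apply: base_vertsP.
case: o ho => [u|] hu /=; last by rewrite xi_isolated ?wf_grown ?IH.
have um : (u < m)%N.
  by case/orP: hu => [/(grown_lt vl)/andP[]//|/andP[/eqP-> _]].
have uV : w u \in grown_verts (base_verts rooted) l.
  rewrite (grown_vertsP _ _ vl); case/orP: hu => [ul|/andP[/eqP -> ->]] /=.
    by rewrite map_f ?orbT.
  by rewrite w0.
rewrite xi_leaf ?wf_grown ?IH //; congr (_ + _ * _).
have vp := valid_prune u vl; rewrite -IH //; last first.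
  by rewrite size_map size_filter (leq_trans (count_size _ _)).
have ub : (0 < u)%N -> w u \notin V0 by move=> u0; rewrite w_new // u0.
congr Defs.xi.
- apply/setP=> t; rewrite in_setD1 (grown_vertsP _ _ vl) (grown_vertsP _ _ vp) grown_prune.
  have -> : (t \in base_verts (rooted && (u != 0%N))) = (t != w u) && (t \in base_verts rooted).
    have [->|u0] := eqVneq u 0%N; first
      by rewrite andbF; case: rooted {IH vl hu vV uV vp}; rewrite !in_setD1 // andbA andbb.
    rewrite andbT; case: eqP => // ->; apply/negP => /base_vertsP; apply/negP.
    by rewrite ub // lt0n.
  have -> : (t \in [seq w i | i <- grown l & i != u]) = (t != w u) && (t \in map w (grown l)).
    apply/mapP/andP => [[i]|[tu /mapP[i il ti]]].
      rewrite mem_filter => /andP[iu il] ->; rewrite map_f //; split=> //.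
      by apply: contra_neq iu; apply: w_inj um; case/andP: (grown_lt vl il).
    by exists i; rewrite // mem_filter il andbT; apply: contra_neq tu => <-.
  by rewrite andb_orr.
- by rewrite (delete_at_grown _ um vl) delete_at_base.
Qed.

End GrownTrees.

(** Both lists describe the same tree with the same names, 10 being the leaf at 2 and 11 the leaf at
    5; only the edge at the root 0 differs. They are written in the order of growth and reversed
    because growths are stored latest first. *)
Definition growth1 : growth := rev [:: (Some 0, 3); (Some 3, 2); (Some 2, 1); (Some 2, 10);
  (Some 3, 4); (Some 4, 5); (Some 5, 11); (Some 5, 6); (Some 6, 7); (Some 7, 8); (Some 8, 9)]%N.

Definition growth2 : growth := rev [:: (Some 0, 6); (Some 6, 5); (Some 5, 11); (Some 5, 4);
  (Some 4, 3); (Some 3, 2); (Some 2, 1); (Some 2, 10); (Some 6, 7); (Some 7, 8); (Some 8, 9)]%N.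

(** Both sides unfold to explicit polynomials in [x], [y], [z], [a], [b], compared by expansion.
    This is where the choice of the vertices 3 and 6 is used. *)
Lemma eval_growth12 (R : comNzRingType) (x y z a b : R) :
  eval_growth x y z a b 11 true growth1 = eval_growth x y z a b 11 true growth2.
Proof. by rewrite /=; ring. Qed.

(** * Pendant trees and mates *)

Section Unordered.
Variables (n : nat) (R : comNzRingType) (x y z : R).
Implicit Types (e : 'I_n * 'I_n) (V : {set 'I_n}) (s t : seq ('I_n * 'I_n)).
Local Notation xi := (xi x y z).

(** Edge lists of graphs are oriented by increasing labels, grown edges from parent to child; both
    are normalised before being compared. *)
Definition ordered_edge e := if (e.1 <= e.2)%N then e else (e.2, e.1).

Lemma wf_ordered V s : wf_edges V s -> wf_edges V (map ordered_edge s).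
Proof.
move=> /allP wf; apply/allP => _ /mapP[e /wf/andP[e1 e2] ->].
by rewrite /ordered_edge; case: ifP => _; rewrite /= e1 e2.
Qed.

Lemma xi_ordered V s : wf_edges V s -> xi V (map ordered_edge s) = xi V s.
Proof.
(* Only the head of a list can be flipped, so each edge is treated there and then moved to the
   accumulator [t]. *)
suff h t : wf_edges V (s ++ t) -> xi V (map ordered_edge s ++ t) = xi V (s ++ t).
  by move=> wf; have := h [::]; rewrite !cats0; apply.
elim: s t => //= e s IH t /andP[we wst].
have -> : xi V (ordered_edge e :: map ordered_edge s ++ t) = xi V (e :: map ordered_edge s ++ t).
  rewrite /ordered_edge; case: ifP => // _; case: e we => a b /= we.
  apply: xi_flip; rewrite /wf_edges /= andbC in we *; rewrite we /=.
  by move: wst; rewrite /wf_edges !all_cat => /andP[ws ->]; rewrite andbT; apply: wf_ordered.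
have wf2 : wf_edges V (map ordered_edge s ++ rcons t e).
  move: wst; rewrite /wf_edges !all_cat all_rcons we => /andP[ws ->].
  by rewrite !andbT; apply: wf_ordered.
have p s1 : perm_eq (s1 ++ rcons t e) (e :: s1 ++ t).
  by rewrite -rcons_cat perm_rcons.
rewrite -(xi_perm _ _ _ wf2 (p _)) IH; last first.
  by move: wst; rewrite /wf_edges !all_cat all_rcons we.
apply: xi_perm; last exact: p.
by move: wst; rewrite /wf_edges !all_cat all_rcons we.
Qed.

Lemma xi_unordered V s t : wf_edges V s -> wf_edges V t ->
  perm_eq (map ordered_edge s) (map ordered_edge t) -> xi V s = xi V t.
Proof.
by move=> ws wt p; rewrite -xi_ordered // -(xi_ordered wt); apply: xi_perm p; apply: wf_ordered.
Qed.

End Unordered.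

Lemma mem_edge_list n (G : sgraph n) e : (e \in edge_list G) = (e.1 < e.2)%N && adj G e.1 e.2.
Proof. by rewrite mem_filter [X in _ && X]mem_enum andbT. Qed.

Definition tree_adj (l : growth) (i j : nat) := ((Some i, j) \in l) || ((Some j, i) \in l).

(* [w 1, ..., w 11] span a copy of the tree grown by [l] at the root [w 0], and
   have no other neighbours. *)
Definition pendant (l : growth) n (G : sgraph n) (w : nat -> 'I_n) :=
  (forall i j, (i < 12)%N -> (j < 12)%N -> w i = w j -> i = j) /\
  (forall i y, (0 < i < 12)%N ->
     adj G (w i) y = has (fun j => tree_adj l i j && (y == w j)) (iota 0 12)).

(** Among the root and the vertices grown earlier, each vertex is adjacent in the whole tree only to
    its parent. This makes [drawn_leaf] applicable at each step of the growth and is decidable by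
    computation. *)
Fixpoint leafy (l l' : growth) : bool :=
  if l' is (o, v) :: l'' then
    [&& leafy l l'', tree_adj l v 0 ==> (o == Some 0) &
        all (fun j => tree_adj l v j ==> (o == Some j)) (grown l'')]
  else true.

Section Pendant.
Variables (l : growth) (n : nat) (G : sgraph n) (w : nat -> 'I_n).
Hypothesis Gw : pendant l G w.

Lemma pendant_adj i j : (0 < i < 12)%N -> (j < 12)%N -> adj G (w i) (w j) = tree_adj l i j.
Proof.
move=> i12 j12; have [wI ->] // := Gw; apply/hasP/idP => [[j' + /andP[ij' /eqP e]]|ij].
  by rewrite mem_iota add0n => /= j'12; rewrite (wI j j').
by exists j; rewrite ?mem_iota // ij eqxx.
Qed.

Lemma pendant_nbr i y : (0 < i < 12)%N -> adj G (w i) y ->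
  exists j, [/\ (j < 12)%N, y = w j & tree_adj l i j].
Proof.
move=> i12; have [_ ->] // := Gw; case/hasP=> j; rewrite mem_iota => j12 /andP[ij /eqP ->].
by exists j.
Qed.

Definition outside : {set 'I_n} := ~: [set w i | i : 'I_12 & (0 < i)%N].

Lemma outsideP y : y \notin outside -> exists i, (0 < i < 12)%N /\ y = w i.
Proof.
rewrite inE negbK => /imsetP[i]; rewrite inE => i0 ->.
by exists i; rewrite i0 ltn_ord.
Qed.

Lemma w_notin_outside i : (0 < i < 12)%N -> w i \notin outside.
Proof.
move=> /andP[i0 i12]; rewrite inE negbK; apply/imsetP; exists (Ordinal i12) => //.
by rewrite inE.
Qed.

Lemma w0_outside : w 0 \in outside.
Proof.
rewrite inE; apply/imsetP => -[i]; rewrite inE => i0 e.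
by have [/(_ 0 i isT (ltn_ord i) e)] := Gw; lia.
Qed.

Lemma grown_verts_outside : all (mem (grown l)) (iota 1 11) ->
  grown_verts w outside l = [set: 'I_n].
Proof.
move=> full; apply/setP=> y; rewrite inE; apply/idP.
have sub l' (B : {set 'I_n}) : y \in B \/ (exists2 i, i \in grown l' & y = w i) -> y \in grown_verts w B l'.
  elim: l' => [|[o v] l' IH] /=; first by case=> // -[].
  rewrite in_setU1 => h; apply/orP; case: h => [yB|[i + e]]; first by right; apply: IH; left.
  by rewrite inE => /orP[/eqP <-|il]; [left; apply/eqP | right; apply: IH; right; exists i].
apply: sub; case: (boolP (y \in outside)) => [|/outsideP[i [i12 ->]]]; [by left|right].
by exists i => //; apply: (allP full); rewrite mem_iota; lia.
Qed.

Lemma drawn_pendant k : valid_growth 12 true l -> all (mem (grown l)) (iota 1 11) -> leafy l l ->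
  drawn k G outside -> drawn k G [set: 'I_n].
Proof.
move=> valid full lfl dr; rewrite -(grown_verts_outside full); have [wI _] := Gw.
suff h l' : leafy l l' -> valid_growth 12 true l' -> drawn k G (grown_verts w outside l').
  exact: h lfl valid.
elim: l' => [|[o v] l' IH] //=.
case/and3P=> lf h0 hall /and4P[vl nv v12 ho].
have vA : w v \notin grown_verts w outside l'.
  rewrite (grown_vertsP _ _ _ vl) negb_or w_notin_outside //=.
  by rewrite (w_mem (m := 12) wI _ vl) //; case/andP: v12.
have only x : x \in grown_verts w outside l' -> adj G (w v) x -> exists2 u, o = Some u & x = w u.
  move=> xA /(pendant_nbr v12)[j [j12 e vj]]; move: xA.
  rewrite {x}e (grown_vertsP _ _ _ vl) (w_mem (m := 12) wI _ vl) //.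
  case/orP=> [jo|jl'].
    have j0 : j = 0 by case: j jo j12 {vj} => // j jo j12; move: jo; rewrite (negPf (@w_notin_outside _ _)).
    by subst j; exists 0 => //; move: h0; rewrite vj => /eqP.
  by exists j => //; have := allP hall _ jl'; rewrite vj => /eqP.
case: o h0 hall ho only => [u|] _ _ ho only.
  apply: (@drawn_leaf _ _ _ _ (w u)) (IH lf vl) => //.
    rewrite (grown_vertsP _ _ _ vl); case/orP: ho => [ul|/andP[/eqP-> _]].
      by rewrite map_f ?orbT.
    by rewrite w0_outside.
  by move=> x xA /(only _ xA)[u' [->]].
apply: (@drawn_leaf _ _ _ _ (w 0)) (IH lf vl) => //.
  by rewrite (grown_vertsP _ _ _ vl) w0_outside.
by move=> x xA /(only _ xA)[].
Qed.

Definition outside_edges := [seq e <- edge_list G | (e.1 \in outside) && (e.2 \in outside)].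

Lemma mem_outside_edges e : (e \in outside_edges) =
  [&& e.1 \in outside, e.2 \in outside, (e.1 < e.2)%N & adj G e.1 e.2].
Proof. by rewrite mem_filter mem_edge_list -andbA. Qed.

Lemma wf_outside_edges : wf_edges outside outside_edges.
Proof. by apply/allP => e; rewrite mem_filter => /andP[]. Qed.

Lemma mem_grown_edges s l' e : (e \in grown_edges w s l') =
  (e \in s) || has (fun e' => if e'.1 is Some u then e == (w u, w e'.2) else false) l'.
Proof.
elim: l' => [|[[u|] v] l' IH] /=; rewrite ?orbF // ?inE IH; by rewrite orbCA.
Qed.

Lemma adj_grown_edges : valid_growth 12 true l -> forall a b,
  ((a, b) \in grown_edges w outside_edges l) || ((b, a) \in grown_edges w outside_edges l) = adj G a b.
Proof.
move=> vl.
have le u v : (Some u, v) \in l -> [/\ (u < 12)%N, (0 < v < 12)%N & adj G (w u) (w v)].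
  move=> uv; have vl' : v \in grown l by apply/mapP; exists (Some u, v).
  have v12 := grown_lt vl vl'; suff u12 : (u < 12)%N.
    by rewrite adj_sym pendant_adj // /tree_adj uv orbT.
  elim: (l) vl uv {vl'} => [|[o v'] l' IH] //= /and4P[vl' _ _ ho]; rewrite inE => /orP[/eqP[e _]|]; last exact: IH.
  by move: ho; rewrite -e => /orP[/(grown_lt vl')/andP[]//|/andP[/eqP-> _]].
have sound c d : (c, d) \in grown_edges w outside_edges l -> adj G c d.
  rewrite mem_grown_edges => /orP[|/hasP[[[u|] v] uv] //= /eqP[-> ->]].
    by rewrite mem_outside_edges => /and4P[].
  by have [] := le _ _ uv.
have inl c d i : c = w i -> (0 < i < 12)%N -> adj G c d ->
  ((c, d) \in grown_edges w outside_edges l) || ((d, c) \in grown_edges w outside_edges l).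
  move=> -> i12 /(pendant_nbr i12)[j [j12 -> /orP[h|h]]]; apply/orP; [left|right];
    rewrite mem_grown_edges; apply/orP; right; apply/hasP.
    by exists (Some i, j) => //=.
  by exists (Some j, i) => //=.
move=> a b; apply/idP/idP => [/orP[/sound|/sound]//|ab]; first by rewrite adj_sym.
have [ao|/outsideP[i [i12 e]]] := boolP (a \in outside); last exact: inl e i12 ab.
have [bo|/outsideP[i [i12 e]]] := boolP (b \in outside); last first.
  by rewrite orbC; apply: inl e i12 _; rewrite adj_sym.
rewrite !mem_grown_edges !mem_outside_edges /= ao bo ab (adj_sym G b) ab !andbT /=.
by have := adj_neq ab; rewrite -val_eqE /= neq_ltn => /orP[] ->; rewrite ?orbT.
Qed.

Lemma mem_ordered_edges s (a b : 'I_n) : (a < b)%N ->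
  ((a, b) \in map (@ordered_edge n) s) = ((a, b) \in s) || ((b, a) \in s).
Proof.
move=> ab; apply/mapP/orP => [[[c d] cd]|[h|h]]; rewrite /ordered_edge /=.
- by case: ifP => _ [-> ->]; [left|right].
- by exists (a, b); rewrite // /= ltnW.
- by exists (b, a); rewrite //= leqNgt ab.
Qed.

(** Once orientations are normalised, the edge list of the graph and the grown list are
    duplicate-free with the same members, hence permutations of each other. *)
Lemma edge_elimination_pendant :
    valid_growth 12 true l -> all (mem (grown l)) (iota 1 11) -> (size l <= 11)%N ->
  edge_elimination G = eval_growth (mvar 0%R) (mvar 1%R) (mvar 2%R)
    (xi (mvar 0%R) (mvar 1%R) (mvar 2%R) outside outside_edges)
    (xi (mvar 0%R) (mvar 1%R) (mvar 2%R) (outside :\ w 0) (delete_at (w 0) outside_edges))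
    11 true l.
Proof.
move=> vl full sl; have [wI _] := Gw.
have wn i : (0 < i < 12)%N -> w i \notin outside by apply: w_notin_outside.
have wfg := @wf_grown _ 12 w _ _ w0_outside wf_outside_edges.
rewrite -(@xi_grown _ _ _ _ _ 12 w _ _ wI w0_outside wn wf_outside_edges isT 11 true l sl vl) /=.
rewrite (grown_verts_outside full) /edge_elimination; apply: xi_unordered.
- by apply/allP => e _; rewrite !inE.
- by apply/allP => e _; rewrite !inE.
have ord_id : map (@ordered_edge n) (edge_list G) = edge_list G.
  rewrite -[RHS]map_id; apply/eq_in_map => e; rewrite mem_edge_list => /andP[lt _].
  by rewrite /ordered_edge ltnW.
have uel : uniq (edge_list G) by rewrite filter_uniq // enum_uniq.
apply: uniq_perm; first by rewrite ord_id.
  elim: (l) vl => [|[o v] l' IH] /=.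
    suff -> : map (@ordered_edge n) outside_edges = outside_edges by rewrite filter_uniq.
    rewrite -[RHS]map_id; apply/eq_in_map => e; rewrite mem_outside_edges => /and4P[_ _ lt _].
    by rewrite /ordered_edge ltnW.
  case/and4P=> vl' nv v12 ho; case: o ho => [u|] /= _; last exact: IH.
  rewrite IH // andbT; apply/mapP => -[e he oe].
  have := allP (wfg true l' vl') _ he; rewrite /= !(grown_vertsP _ _ _ vl') => /andP[h1 h2].
  have : w v \notin grown_verts w outside l'.
    rewrite (grown_vertsP _ _ _ vl') (negPf (wn _ v12)) (w_mem (m := 12) wI _ vl') //.
    by case/andP: v12.
  rewrite (grown_vertsP _ _ _ vl'); apply/negP; rewrite negbK.
  case: e h1 h2 oe {he} => a b /= h1 h2; rewrite /ordered_edge /=.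
  by case: ifP => _; case: ifP => _ [e1 e2]; rewrite ?[w v]e1 ?[w v]e2.
move=> -[a b]; rewrite ord_id mem_edge_list /=.
have [ab|ba] := ltnP a b; first by rewrite mem_ordered_edges // adj_grown_edges.
apply/esym/negP => /mapP[[c d] cd]; have : adj G c d by rewrite -adj_grown_edges // cd.
move/adj_neq; rewrite -val_eqE /ordered_edge /= => ne.
by case: ifP => h [e1 e2]; subst; move: ba ne; rewrite leq_eqVlt; lia.
Qed.

End Pendant.

(** * An isomorphism invariant separating a graph from its mate *)

Definition deg n (G : sgraph n) v := #|nbr G v|.

(** Tailored to vertex 2 of the tree, with its leaves 1 and 10: its third neighbour, vertex 3, has
    degree 3 exactly when the root hangs there. *)
Definition broom n (G : sgraph n) v :=
  [&& deg G v == 3, #|[set y in nbr G v | deg G y == 1]| == 2 &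
      #|[set y in nbr G v | deg G y == 3]| == 1].

Lemma broom_morph n m (G : sgraph n) (H : sgraph m) (f : 'I_n -> 'I_m) v :
    injective f -> nbr H (f v) = f @: nbr G v ->
    (forall y, deg H (f y) = deg G y) -> broom H (f v) = broom G v.
Proof.
move=> fI fn fd; rewrite /broom fd.
have e d : #|[set y in nbr H (f v) | deg H y == d]| = #|[set y in nbr G v | deg G y == d]|.
  rewrite -(card_imset _ fI); apply: eq_card => y; rewrite inE fn.
  apply/andP/imsetP => [[/imsetP[x xv ->] h]|[x + ->]].
    by exists x; rewrite // inE xv -fd.
  by rewrite inE fd => /andP[xv ->]; rewrite imset_f.
by rewrite !e.
Qed.

Lemma isomorphic_broom n m (G : sgraph n) (H : sgraph m) : isomorphic G H ->
  #|[set v | broom G v]| = #|[set v | broom H v]|.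
Proof.
case=> f [g fK gK] fE; have fI := can_inj fK.
have fn v : nbr H (f v) = f @: nbr G v.
  apply/setP=> y; rewrite inE; apply/idP/imsetP => [vy|[x + ->]]; last by rewrite inE fE.
  by exists (g y); rewrite ?gK // inE -fE gK.
have fd v : deg H (f v) = deg G v by rewrite /deg fn card_imset.
rewrite -(card_imset _ fI); apply: eq_card => y; rewrite inE.
apply/imsetP/idP => [[x + ->]|by_]; first by rewrite inE (broom_morph fI (fn _) fd).
by exists (g y); rewrite ?gK // inE -(broom_morph fI (fn _) fd) gK.
Qed.

Definition tree_deg l i := count (tree_adj l i) (iota 0 12).

(* [b1] and [b3] tell whether the root has degree 1, respectively 3. *)
Definition tree_broom l (b1 b3 : bool) i :=
  [&& tree_deg l i == 3,
      count (fun j => tree_adj l i j && (if j is 0 then b1 else tree_deg l j == 1)) (iota 0 12) == 2 &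
      count (fun j => tree_adj l i j && (if j is 0 then b3 else tree_deg l j == 3)) (iota 0 12) == 1].

Section PendantBroom.
Variables (l : growth) (n : nat) (G : sgraph n) (w : nat -> 'I_n).
Hypothesis Gw : pendant l G w.

Lemma card_pendant_nbr i (P : pred 'I_n) (Q : pred nat) : (0 < i < 12)%N ->
    (forall j, (j < 12)%N -> P (w j) = Q j) ->
  #|[set y in nbr G (w i) | P y]| = count (fun j => tree_adj l i j && Q j) (iota 0 12).
Proof.
move=> i12 PQ; have [wI _] := Gw.
rewrite -size_filter -(size_map w) -(card_uniqP _); last first.
  rewrite map_inj_in_uniq ?filter_uniq ?iota_uniq // => a b.
  by rewrite !mem_filter !mem_iota => /andP[_ a12] /andP[_ b12]; apply: wI.
apply: eq_card => y; rewrite !inE; apply/andP/mapP => [[iy Py]|[j + ->]].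
  have [j [j12 e ij]] := pendant_nbr Gw i12 iy.
  by exists j; rewrite // mem_filter mem_iota ij -PQ // -e Py.
by rewrite mem_filter mem_iota add0n => /andP[/andP[ij Qj] j12]; rewrite (pendant_adj Gw) // PQ.
Qed.

Lemma deg_pendant i : (0 < i < 12)%N -> deg G (w i) = tree_deg l i.
Proof.
move=> i12; rewrite /deg (_ : nbr G (w i) = [set y in nbr G (w i) | true]).
  by rewrite (@card_pendant_nbr _ _ xpredT) //; apply: eq_count => j; rewrite andbT.
by apply/setP=> y; rewrite !inE andbT.
Qed.

Lemma broom_pendant i : (0 < i < 12)%N ->
  broom G (w i) = tree_broom l (deg G (w 0) == 1) (deg G (w 0) == 3) i.
Proof.
move=> i12; rewrite /broom /tree_broom deg_pendant //.
have e d : #|[set y in nbr G (w i) | deg G y == d]| =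
    count (fun j => tree_adj l i j && (if j is 0 then deg G (w 0) == d else tree_deg l j == d)) (iota 0 12).
  by apply: card_pendant_nbr => // -[|j] j12 //; rewrite deg_pendant.
by rewrite !e.
Qed.

End PendantBroom.

Section Mate.
Variables (k n : nat) (G : sgraph n) (w : nat -> 'I_n).
Hypotheses (GC : G \in genus_class k n) (Gw : pendant growth1 G w).

Definition moved : sgraph n := graph_of (fun x y =>
  [&& adj G x y, ~~ ((x == w 0) && (y == w 3)) & ~~ ((y == w 0) && (x == w 3))]
  || (x == w 0) && (y == w 6)).

Let wI i j : (i < 12)%N -> (j < 12)%N -> (w i == w j) = (i == j).
Proof. by move=> i12 j12; apply/eqP/eqP => [|->//]; apply: Gw.1. Qed.

Lemma adj_moved x y : adj moved x y =
  [|| [&& adj G x y, ~~ ((x == w 0) && (y == w 3)) & ~~ ((y == w 0) && (x == w 3))],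
      (x == w 0) && (y == w 6) | (y == w 0) && (x == w 6)].
Proof.
rewrite adj_graph_of; have [->|xy] /= := eqVneq x y.
  rewrite adj_irr /= orbb; apply/esym/negP => /andP[/eqP -> ].
  by rewrite wI.
rewrite (adj_sym G y); case: (adj G x y) => //=.
by case: (x == w 0); case: (y == w 3); case: (y == w 0); case: (x == w 3);
   case: (y == w 6); case: (x == w 6).
Qed.

Lemma tree_adj12 i j : (0 < i < 12)%N -> (j < 12)%N -> tree_adj growth2 i j =
  [|| [&& tree_adj growth1 i j, ~~ ((i == 0) && (j == 3)) & ~~ ((j == 0) && (i == 3))],
      (i == 0) && (j == 6) | (j == 0) && (i == 6)].
Proof.
move=> i12 j12; apply/eqP.
have /allP/(_ i) : all (fun i => all (fun j => tree_adj growth2 i j ==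
  [|| [&& tree_adj growth1 i j, ~~ ((i == 0) && (j == 3)) & ~~ ((j == 0) && (i == 3))],
      (i == 0) && (j == 6) | (j == 0) && (i == 6)]) (iota 0 12)) (iota 1 11) by vm_compute.
rewrite mem_iota => /(_ i12)/allP/(_ j); apply; by rewrite mem_iota.
Qed.

Lemma pendant_moved : pendant growth2 moved w.
Proof.
have adjE i j : (0 < i < 12)%N -> (j < 12)%N -> adj moved (w i) (w j) = tree_adj growth2 i j.
  move=> i12 j12; have [_ i12'] := andP i12.
  by rewrite adj_moved (pendant_adj Gw) // !wI // tree_adj12.
split=> [|i y i12]; first exact: Gw.1.
apply/idP/hasP => [iy|[j + /andP[ij /eqP ->]]]; last first.
  by rewrite mem_iota add0n => /= j12; rewrite adjE.
suff [j j12 e] : exists2 j, (j < 12)%N & y = w j.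
  by exists j; rewrite ?mem_iota // e eqxx -adjE // -e iy.
move: iy; rewrite adj_moved => /or3P[/and3P[iy _ _]|/andP[_ /eqP ->]|/andP[/eqP -> _]].
- by have [j [j12 -> _]] := pendant_nbr Gw i12 iy; exists j.
- by exists 6.
- by exists 0.
Qed.

Lemma outside_moved x y : x \in outside w -> y \in outside w -> adj moved x y = adj G x y.
Proof.
have ne i x' : (0 < i < 12)%N -> x' \in outside w -> (x' == w i) = false.
  by move=> i12 x'o; apply/eqP => e; move: x'o; rewrite e (negPf (w_notin_outside w i12)).
by move=> xo yo; rewrite adj_moved !(ne 3) // !(ne 6) // !andbF /= !andbT orbF.
Qed.

(** The part outside the tree is unchanged and keeps its drawing; the tree is then regrown leaf by
    leaf from the root without raising the genus. *)
Lemma moved_class : moved \in genus_class k n.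
Proof.
apply/genus_class_drawn; apply: (drawn_pendant pendant_moved); [by vm_compute..|].
have /genus_class_drawn := GC; apply: (@drawn_morph _ _ _ _ _ id); [by move=> x y|by move=> x _; rewrite inE|].
by move=> x y xo yo; rewrite outside_moved.
Qed.

Lemma moved_xi : edge_elimination G = edge_elimination moved.
Proof.
rewrite (edge_elimination_pendant Gw) ?(edge_elimination_pendant pendant_moved); [|by vm_compute..].
rewrite eval_growth12; have -> // : outside_edges moved w = outside_edges G w.
have e x y : (x \in outside w) && (y \in outside w) -> adj moved x y = adj G x y.
  by case/andP => xo yo; apply: outside_moved.
rewrite /outside_edges /edge_list -!filter_predI; apply: eq_filter => -[x y] /=.
by case: (boolP ((x \in outside w) && (y \in outside w))) => //= /e ->.
Qed.

(** Only the root changes neighbours, trading [w 3] for [w 6]. These have degrees 3 and 2 before and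
    2 and 3 after, so interchanging them also preserves degrees. *)
Lemma nbr_moved_outside v : v \in outside w -> nbr moved v = tperm (w 3) (w 6) @: nbr G v.
Proof.
move=> vo; have ne i : (0 < i < 12)%N -> (v == w i) = false.
  by move=> i12; apply/eqP => e; move: vo; rewrite e (negPf (w_notin_outside w i12)).
have vG i : (0 < i < 12)%N -> adj G v (w i) = (v == w 0) && tree_adj growth1 i 0.
  move=> i12; rewrite adj_sym; apply/idP/andP => [/(pendant_nbr Gw i12)[[|j] [j12 e ij]]|[/eqP -> h]].
  - by rewrite e eqxx.
  - by move: (ne j.+1 j12); rewrite e eqxx.
  - by rewrite (pendant_adj Gw).
have vM y : adj moved v y = adj G v (tperm (w 3) (w 6) y).
  rewrite adj_moved !(ne 3) // !(ne 6) // !andbF /= orbF andbT.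
  case: tpermP => [->|->|/eqP y3 /eqP y6].
  - by rewrite eqxx andbT wI // andbF orbF !vG //=; case: (v == w 0).
  - by rewrite eqxx andbT wI // andbF andbT !vG //=; case: (v == w 0).
  - by rewrite (negPf y3) (negPf y6) !andbF andbT orbF.
apply/setP=> y; rewrite inE vM; apply/idP/imsetP => [h|[x + ->]]; last by rewrite inE tpermK.
by exists (tperm (w 3) (w 6) y); rewrite ?inE ?tpermK.
Qed.

Lemma deg_moved v : deg moved (tperm (w 3) (w 6) v) = deg G v.
Proof.
case: tpermP => [->|->|/eqP v3 /eqP v6].
- by rewrite (deg_pendant Gw) // (deg_pendant pendant_moved).
- by rewrite (deg_pendant Gw) // (deg_pendant pendant_moved).
have [vo|/outsideP[i [i12 e]]] := boolP (v \in outside w).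
  by rewrite /deg nbr_moved_outside // card_imset //; apply: perm_inj.
rewrite e (deg_pendant Gw) // (deg_pendant pendant_moved) //; apply/eqP.
have /allP/(_ i) : all (fun i => [|| i == 3, i == 6 | tree_deg growth2 i == tree_deg growth1 i]) (iota 1 11) by vm_compute.
by rewrite mem_iota => /(_ i12); rewrite e !wI // in v3 v6; rewrite ?(negPf v3) ?(negPf v6); case/andP: i12.
Qed.

(** Outside the tree the brooms are the same in both graphs. Inside it, [moved] has none, whereas
    [w 2] is one in [G]; so the two graphs have different numbers of brooms. *)
Lemma moved_not_isomorphic : ~ isomorphic G moved.
Proof.
move=> /isomorphic_broom; apply/eqP; rewrite eq_sym neq_ltn; apply/orP; left.
apply: proper_card; apply/properP; split; last first.
  exists (w 2); rewrite inE; first by rewrite (broom_pendant Gw) //; vm_compute.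
  by rewrite (broom_pendant pendant_moved) //; vm_compute.
apply/subsetP => v; rewrite !inE.
have [vo|/outsideP[i [i12 ->]]] := boolP (v \in outside w).
  have ne i : (0 < i < 12)%N -> v != w i.
    by move=> i12; apply: contraTneq vo => ->; apply: w_notin_outside.
  have tv : tperm (w 3) (w 6) v = v by rewrite tpermD // eq_sym ne.
  rewrite -{1}tv (@broom_morph _ _ G) //; [exact: perm_inj|by rewrite tv nbr_moved_outside|exact: deg_moved].
rewrite (broom_pendant pendant_moved) // => h; exfalso; move: h.
(* The degree of the root is not known, so every combination of the two flags is checked. *)
have : all (fun i => ~~ [|| tree_broom growth2 false false i, tree_broom growth2 true false i,
  tree_broom growth2 false true i | tree_broom growth2 true true i]) (iota 1 11) by vm_compute.
move/allP/(_ i); rewrite mem_iota => /(_ i12).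
case: (_ == 1); case: (_ == 3); rewrite !negb_or => /and4P[/negPf h1 /negPf h2 /negPf h3 /negPf h4];
  by rewrite ?h1 ?h2 ?h3 ?h4.
Qed.

End Mate.

(** * Counting attachments *)

Lemma pendant_not_unique k n (G : sgraph n) w : pendant growth1 G w ->
  G \notin unique_graphs edge_elimination (genus_class k) n.
Proof.
move=> Gw; rewrite in_set; apply/negP => /andP[GC /asboolP[]].
exists n, (moved G w); split; first exact: moved_class GC Gw.
by split; [exact: moved_not_isomorphic Gw | exact: moved_xi Gw].
Qed.

Section Attach.
Variable n : nat.
Local Notation N := (n + 11)%N.

Lemma complement_enum (f : {ffun 'I_11 -> 'I_N}) : injectiveb f ->
  exists g : 'I_n -> 'I_N, injective g /\ forall y, (y \in codom g) = (y \notin codom f).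
Proof.
move=> /injectiveP fI; pose A := ~: [set f i | i : 'I_11].
have cA : #|A| = n by rewrite cardsCs setCK card_imset // !card_ord addnK.
exists (fun i => enum_val (cast_ord (esym cA) i)); split.
  by move=> i j /enum_val_inj/cast_ord_inj.
move=> y; transitivity (y \in A).
  apply/codomP/idP => [[i ->]|yA]; first exact: enum_valP.
  exists (cast_ord cA (enum_rank_in yA y)).
  by rewrite cast_ordK enum_rankK_in.
by rewrite !inE; congr (~~ _); apply/imsetP/codomP => [[i _ ->]|[i ->]]; exists i.
Qed.

(** The placement of the base graph depends on [f] alone, which is what lets [f] determine the whole
    attachment in [fibre_inj]. The value for non-injective [f] is a mere default. *)
Definition complement_fun (f : {ffun 'I_11 -> 'I_N}) : 'I_n -> 'I_N :=
  if pselect (injectiveb f) is left fI then projT1 (cid (complement_enum fI))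
  else fun i => widen_ord (leq_addr 11 n) i.

Section Fixed.
Variables (f : {ffun 'I_11 -> 'I_N}) (G0 : sgraph n) (r : 'I_n).
Hypothesis fI : injectiveb f.
Let g := complement_fun f.

Lemma complement_funP : injective g /\ forall y, (y \in codom g) = (y \notin codom f).
Proof. by rewrite /g /complement_fun; case: pselect => // fI'; case: cid. Qed.

Definition tree_vertex (i : nat) : 'I_N := if i is j.+1 then f (inord j) else complement_fun f r.

Definition attach : sgraph N := graph_of (fun x y =>
  [exists a, exists b, [&& x == complement_fun f a, y == complement_fun f b & adj G0 a b]] ||
  [exists i : 'I_12, exists j : 'I_12,
    [&& x == tree_vertex i, y == tree_vertex j & tree_adj growth1 i j]]).

Lemma tree_vertex_gf i a : (0 < i)%N -> tree_vertex i = g a -> False.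
Proof.
case: i => //= i _ e; have [_ h] := complement_funP.
by have := h (g a); rewrite codom_f -e codom_f.
Qed.

Lemma tree_vertex_inj i j : (i < 12)%N -> (j < 12)%N -> tree_vertex i = tree_vertex j -> i = j.
Proof.
case: i j => [|i] [|j] // i12 j12 e.
- by case: (@tree_vertex_gf j.+1 r isT (esym e)).
- by case: (@tree_vertex_gf i.+1 r isT e).
by move/(injectiveP _ fI)/(congr1 val): e => /=; rewrite !inordK // => ->.
Qed.

Lemma tree_adj_sym l i j : tree_adj l i j = tree_adj l j i.
Proof. by rewrite /tree_adj orbC. Qed.

Lemma tree_adj_irr i : tree_adj growth1 i i = false.
Proof. by rewrite /tree_adj orbb !inE; do 12 case: i => [//|i]. Qed.

Lemma adj_attach_g a b : adj attach (g a) (g b) = adj G0 a b.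
Proof.
have [gI _] := complement_funP; rewrite adj_graph_of (inj_eq gI).
have h a' b' : [exists a, exists b, [&& g a' == g a, g b' == g b & adj G0 a b]] ||
  [exists i : 'I_12, exists j : 'I_12,
    [&& g a' == tree_vertex i, g b' == tree_vertex j & tree_adj growth1 i j]] = adj G0 a' b'.
  apply/orP/idP => [[/existsP[c /existsP[d /and3P[/eqP/gI-> /eqP/gI-> //]]]|]|ab]; last first.
    by left; apply/existsP; exists a'; apply/existsP; exists b'; rewrite !eqxx.
  case/existsP=> -[[|i] i12] /existsP[[[|j] j12] /= /and3P[/eqP e1 /eqP e2]].
  - by rewrite tree_adj_irr.
  - by case: (@tree_vertex_gf j.+1 b' isT (esym e2)).
  - by case: (@tree_vertex_gf i.+1 a' isT (esym e1)).
  - by case: (@tree_vertex_gf i.+1 a' isT (esym e1)).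
rewrite !h (adj_sym G0 b) orbb; have [->|] //= := eqVneq a b.
by rewrite adj_irr.
Qed.

Lemma pendant_attach : pendant growth1 attach tree_vertex.
Proof.
split=> [|i y /andP[i0 i12]]; first exact: tree_vertex_inj.
rewrite adj_graph_of; apply/andP/hasP => [[ne]|[j + /andP[ij /eqP ->]]].
  have nog a : tree_vertex i == g a = false by apply/eqP => /(tree_vertex_gf i0).
  case/orP=> /orP[/existsP[a /existsP[b /and3P[h1 h2 _]]]|].
  - by rewrite nog in h1.
  - case/existsP=> i' /existsP[j /and3P[/eqP e /eqP -> ij]]; exists (val j); first by rewrite mem_iota /=.
    by rewrite (tree_vertex_inj i12 (ltn_ord i') e) ij eqxx.
  - by rewrite nog in h2.
  - case/existsP=> i' /existsP[j /and3P[/eqP -> /eqP e ij]]; exists (val i'); first by rewrite mem_iota /=.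
    by rewrite (tree_vertex_inj i12 (ltn_ord j) e) tree_adj_sym ij eqxx.
rewrite mem_iota add0n => /= j12; split.
  apply: contraTneq ij => /(tree_vertex_inj i12 j12) ->; by rewrite tree_adj_irr.
apply/orP; left; apply/orP; right.
by apply/existsP; exists (Ordinal i12); apply/existsP; exists (Ordinal j12); rewrite !eqxx.
Qed.

Lemma outside_g y : y \in outside tree_vertex -> exists a, y = g a.
Proof.
move=> yo; have [_ h] := complement_funP; suff /codomP : y \in codom g by [].
rewrite h; apply/codomP => -[i e]; move: yo.
have i12 : (0 < i.+1 < 12)%N by rewrite /= ltnS ltn_ord.
by rewrite (_ : y = tree_vertex i.+1) ?(negPf (w_notin_outside _ i12)) //= inord_val.
Qed.

Lemma attach_class k : G0 \in genus_class k n -> attach \in genus_class k N.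
Proof.
move=> /genus_class_drawn Gd; apply/genus_class_drawn.
apply: (drawn_pendant pendant_attach); [by vm_compute..|].
pose h y := odflt r [pick a | g a == y].
have [gI _] := complement_funP.
have hg a : h (g a) = a by rewrite /h; case: pickP => [b /eqP/gI //|/(_ a)]; rewrite eqxx.
apply: (@drawn_morph _ _ _ _ _ h) Gd => [x y /outside_g[a ->] /outside_g[b ->]|x _|x y].
- by rewrite !hg => ->.
- by rewrite inE.
- by move=> /outside_g[a ->] /outside_g[b ->]; rewrite !hg adj_attach_g.
Qed.

End Fixed.

Section Ball.
Variable G : sgraph N.

(** Expansion happens only through vertices of degree at most 3, so a root of large degree does not
    spoil the factor 4. *)
Definition ball_step (A : {set 'I_N}) :=
  A :|: \bigcup_(x in A | (#|nbr G x| <= 3)%N) nbr G x.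

Lemma card_ball_step (A : {set 'I_N}) : (#|ball_step A| <= 4 * #|A|)%N.
Proof.
rewrite cardsU; apply: leq_trans (leq_subr _ _) _; rewrite mulSn leq_add2l.
apply: leq_trans (_ : \sum_(x in A | (#|nbr G x| <= 3)%N) #|nbr G x| <= _)%N.
  elim/big_rec2: _ => [|x m B _ le]; first by rewrite cards0.
  by rewrite cardsU (leq_trans (leq_subr _ _)) // leq_add2l.
apply: leq_trans (_ : \sum_(x in A | (#|nbr G x| <= 3)%N) 3 <= _)%N.
  by apply: leq_sum => x /andP[].
rewrite big_mkcondr /= mulnC -sum_nat_const; apply: leq_sum => x _; by case: ifP.
Qed.

Lemma card_ball m (A : {set 'I_N}) : (#|iter m ball_step A| <= 4 ^ m * #|A|)%N.
Proof.
elim: m => [|m IH]; first by rewrite mul1n.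
by rewrite iterS expnS -mulnA (leq_trans (card_ball_step _)) // leq_mul2l IH.
Qed.

Definition reach (s : seq nat) := s ++ [seq j <- iota 1 11 | has (fun i => tree_adj growth1 i j) s].

(** Any two of the eleven tree vertices are joined by a path of length at most 8 that avoids the
    root, and all of them have degree at most 3. *)
Lemma pendant_ball w (A : {set 'I_N}) i j : pendant growth1 G w -> (0 < i < 12)%N -> (0 < j < 12)%N ->
  w i \in A -> w j \in iter 8 ball_step A.
Proof.
move=> Gw i12 j12 iA.
suff h m j' : j' \in iter m reach [:: i] -> (0 < j' < 12)%N /\ w j' \in iter m ball_step A.
  suff /h[] : j \in iter 8 reach [:: i] by [].
  have /allP/(_ i) : all (fun i => all (fun j => j \in iter 8 reach [:: i]) (iota 1 11)) (iota 1 11).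
    by vm_compute.
  by rewrite mem_iota => /(_ i12)/allP/(_ j); rewrite mem_iota; apply.
elim: m j' => [|m IH] j' /=; first by rewrite inE => /eqP ->.
rewrite mem_cat => /orP[/IH[h1 h2]|]; first by rewrite in_setU h2.
rewrite mem_filter mem_iota => /andP[/hasP[i' /IH[i'12 i'A] ij] j'12]; split=> //.
rewrite in_setU; apply/orP; right; apply/bigcupP; exists (w i').
  rewrite i'A -/(deg G (w i')) (deg_pendant Gw) //.
  have /allP/(_ i') : all (fun i => (tree_deg growth1 i <= 3)%N) (iota 1 11) by vm_compute.
  by rewrite mem_iota; apply.
by rewrite inE (pendant_adj Gw) //; case/andP: j'12.
Qed.

End Ball.
End Attach.

Section Counting.
Variable k : nat.
Local Notation C := (genus_class k).
Local Notation U := (unique_graphs edge_elimination C).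

Section Fibre.
Variable n : nat.
Local Notation N := (n + 11)%N.
Let T : finType := (sgraph n * 'I_n * {ffun 'I_11 -> 'I_N})%type.

Definition attachments : {set T} := [set p : T | (p.1.1 \in U n) && injectiveb p.2].

Definition attach_of (p : T) : sgraph N := attach p.2 p.1.1 p.1.2.

Definition fibre (G : sgraph N) : {set T} := [set p in attachments | attach_of p == G].

Lemma pendant_fibre G p : p \in fibre G ->
  [/\ p.1.1 \in U n, injectiveb p.2, attach_of p = G & pendant growth1 G (tree_vertex p.2 p.1.2)].
Proof.
case/setIdP; rewrite in_set => /andP[pU pI] /eqP pG; split=> //.
by rewrite -pG; apply: pendant_attach.
Qed.

(* Two attached trees of the same graph meet, or the root of one belongs to the
   other: otherwise removing one of them leaves the other as a pendant tree of
   a unique graph. *)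
Lemma fibre_meet G p q : p \in fibre G -> q \in fibre G -> exists i j,
  [/\ (0 < i < 12)%N, (j < 12)%N & tree_vertex q.2 q.1.2 i = tree_vertex p.2 p.1.2 j].
Proof.
case/pendant_fibre=> pU pI pG Gp /pendant_fibre[qU qI qG Gq]; apply: contrapT => no.
set w := tree_vertex p.2 p.1.2 in Gp no *; set w1 := tree_vertex q.2 q.1.2 in Gq no *.
have far i j : (0 < i < 12)%N -> (j < 12)%N -> w1 i <> w j.
  by move=> i12 j12 e; apply: no; exists i, j.
have out i : (i < 12)%N -> w1 i \in outside w.
  move=> i12; apply/negPn/negP => /outsideP[j [j12 e]].
  have [i0|i0] := posnP i; last by apply: (far i j); rewrite ?i0 //; case/andP: j12.
  (* If the root of the second tree were a tree vertex of the first, its neighbour [w1 3] would be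
     some [w j'], which [far] forbids. *)
  subst i; have : adj G (w j) (w1 3) by rewrite -e adj_sym (pendant_adj Gq).
  by case/(pendant_nbr Gp j12)=> j' [j'12 e' _]; apply: (far 3 j').
have [gI _] := complement_funP pI; set g := complement_fun p.2 in gI.
pose w' i := odflt p.1.2 [pick a | g a == w1 i].
have w'E i : (i < 12)%N -> g (w' i) = w1 i.
  move=> i12; have [a e] := outside_g pI (out i i12); rewrite /w'.
  by case: pickP => [b /eqP //|/(_ a)]; rewrite e eqxx.
have adjg a b : adj p.1.1 a b = adj G (g a) (g b) by rewrite -pG adj_attach_g.
move: pU; apply/negP; apply: (@pendant_not_unique _ _ _ w'); split=> [i j i12 j12 e|i y i12].
  by apply: (Gq.1 _ _ i12 j12); rewrite -!/(w1 _) -!w'E // e.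
have [_ i12'] := andP i12.
rewrite adjg w'E // Gq.2 //; apply: eq_in_has => j; rewrite mem_iota add0n => /= j12.
by rewrite -/(w1 j) -w'E // (inj_eq gI).
Qed.

(** From [f] the base graph is read off on the complement of the tree, and the root is the neighbour
    of vertex 3 lying outside the tree. *)
Lemma fibre_inj G : {in fibre G &, injective snd}.
Proof.
move=> [[G1 r1] f] [[G2 r2] f'] /pendant_fibre[/= _ fI e1 P1] /pendant_fibre[/= _ _ e2 P2] e.
subst f'; have [gI _] := complement_funP fI; congr (_, _, _).
  apply: sgraph_eq => a b; rewrite -(adj_attach_g G1 r1 fI) -(adj_attach_g G2 r2 fI).
  by rewrite -/(attach_of (G1, r1, f)) -/(attach_of (G2, r2, f)) e1 e2.
have : adj G (tree_vertex f r1 3) (tree_vertex f r1 0) by rewrite (pendant_adj P1).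
case/(pendant_nbr P2 (isT : 0 < 3 < 12)%N)=> -[|j] [j12 ej _]; first exact: gI.
by case: (tree_vertex_gf fI (isT : 0 < j.+1)%N (esym ej)).
Qed.

(** With one attachment fixed, [Z] is its tree with the root. Every other attached tree has a vertex
    in [Z], so all its eleven vertices lie in the ball [B], and the attachment is determined by a
    map from 'I_11 into [B]. *)
Lemma card_fibre G : (#|fibre G| <= (4 ^ 8 * 12) ^ 11)%N.
Proof.
have [->|[p pG]] := set_0Vmem (fibre G); first by rewrite cards0.
pose Z := [set tree_vertex p.2 p.1.2 (i : 'I_12) | i : 'I_12].
pose B := iter 8 (ball_step G) Z.
have cZ : (#|Z| <= 12)%N by rewrite -[X in (_ <= X)%N](card_ord 12) leq_imset_card.
have cB : (#|B| <= 4 ^ 8 * 12)%N by apply: leq_trans (card_ball _ _ _) _; rewrite leq_mul2l cZ orbT.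
rewrite -(card_in_imset (@fibre_inj G)).
apply: leq_trans (_ : #|B| ^ 11 <= _)%N; last by rewrite leq_exp2r.
rewrite -[X in _ ^ X](card_ord 11) -card_ffun_on; apply/subset_leq_card/subsetP => _ /imsetP[q qG ->]; apply/ffun_onP => x.
have [i [j [i12 j12 e]]] := fibre_meet pG qG; have [_ _ _ Gq] := pendant_fibre qG.
have x12 : (0 < x.+1 < 12)%N by rewrite /= ltnS ltn_ord.
have := pendant_ball Gq i12 x12; rewrite /= inord_val; apply.
by rewrite e; apply/imsetP; exists (Ordinal j12).
Qed.

Lemma card_attachments : (#|U n| * n * N ^_ 11 <= (4 ^ 8 * 12) ^ 11 * #|C N|)%N.
Proof.
have -> : (#|U n| * n * N ^_ 11)%N = #|attachments|.
  pose F := [set f : {ffun 'I_11 -> 'I_N} | injectiveb f].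
  have -> : attachments = setX (setX (U n) [set: 'I_n]) F.
    by apply/setP => -[[G r] f]; rewrite [LHS]in_set !in_setX in_setT andbT /F in_set.
  by rewrite !cardsX cardsT card_inj_ffuns !card_ord.
have att p : p \in attachments -> attach_of p \in C N.
  rewrite in_set => /andP[pU pI]; apply: attach_class pI _ _.
  by move: pU; rewrite in_set => /andP[].
rewrite -sum1_card (partition_big attach_of (mem (C N))) //= mulnC -sum_nat_const.
apply: leq_sum => G _; apply: leq_trans (card_fibre G); rewrite -sum1_card.
by apply: eq_leq; apply: eq_bigl => p; rewrite [RHS]in_set.
Qed.

End Fibre.

Lemma ffact_ge n m : (n.+1 ^ m <= (n + m) ^_ m)%N.
Proof.
elim: m => [|m IH]; first by rewrite ffactn0.
by rewrite addnS ffactSS expnS leq_mul // ltnS leq_addr.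
Qed.

(** Attaching trees gives about [n ^ 12] graphs of order [n + 11] per unique graph, up to a
    constant, while eleven growth steps enlarge the class by O([n ^ 11]) only. *)
Lemma card_unique_le : exists L, forall n, (22 * k <= n)%N -> (#|U n| * n <= L * #|C n|)%N.
Proof.
have [K hK] := genus_class_growth k.
have growth_iter n j : (22 * k <= n)%N -> (#|C (n + j)| <= (K * (n + j)) ^ j * #|C n|)%N.
  move=> hn; elim: j => [|j IH]; first by rewrite addn0 mul1n.
  rewrite addnS; apply: leq_trans (hK _ _) _; first by lia.
  rewrite expnS -[X in (_ <= X)%N]mulnA leq_mul2l; apply/orP; right.
  apply: leq_trans IH _; rewrite leq_mul2r; apply/orP; right.
  by case: j => // j; rewrite leq_exp2r // leq_mul2l leqnSn orbT.
have [M hM] : exists M, forall n, (#|U n| * n * (n + 11) ^_ 11 <= M * #|C (n + 11)|)%N.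
  by exists ((4 ^ 8 * 12) ^ 11)%N; apply: card_attachments.
exists (M * (K * 11) ^ 11)%N => n hn.
have p : (0 < n.+1 ^ 11)%N by rewrite expn_gt0.
rewrite -(leq_pmul2r p); apply: leq_trans (_ : _ <= #|U n| * n * (n + 11) ^_ 11)%N _.
  by rewrite leq_mul2l ffact_ge orbT.
(* Uses that [n + 11] is at most [11 * n.+1], so that the factor [n.+1 ^ 11] can be cancelled. *)
have step : ((K * (n + 11)) ^ 11 <= (K * 11) ^ 11 * n.+1 ^ 11)%N.
  by rewrite -expnMn leq_exp2r // -mulnA leq_mul2l; lia.
apply: leq_trans (hM n) _; apply: leq_trans (leq_mul (leqnn M) (growth_iter n 11 hn)) _.
apply: leq_trans (leq_mul (leqnn M) (leq_mul step (leqnn #|C n|))) _.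
by move: (_ ^ _)%N (_ ^ _)%N => x y; rewrite -!mulnA (mulnC x).
Qed.

End Counting.

(** * Passage to the limit *)

Import Num.Theory Order.TTheory numFieldNormedType.Exports.
Local Open Scope ring_scope.
Local Open Scope classical_set_scope.

Theorem theorem6p11 (R : realType) (k : nat) :
  weakly_distinguishing R edge_elimination (genus_class k).
Proof.
have [L hL] := card_unique_le k; rewrite /weakly_distinguishing.
set u := (X in (X : nat -> R) @ \oo --> _).
(* The proportion is at most [L / n], while [harmonic n] is [1 / n.+1]; the factor 2 covers the
   shift, as [n.+1] is at most [2 * n] for positive [n]. *)
have lim : (fun n => (2 * L)%N%:R * harmonic n : R) @ \oo --> (0 : R).
  by rewrite -[X in _ --> X](mulr0 (2 * L)%N%:R); apply: cvgM; [exact: cvg_cst | exact: cvg_harmonic].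
apply: (squeeze_cvgr _ (cvg_cst (0 : R)) lim); near=> n.
have n0 : (0 < n)%N by near: n; exists 1%N.
have hn : (22 * k <= n)%N by near: n; exists (22 * k)%N.
rewrite /u divr_ge0 ?ler0n //= /harmonic.
set c := #|genus_class k n|; set a := #|unique_graphs edge_elimination (genus_class k) n|.
have le : (a * n <= L * c)%N := hL n hn.
(* For an empty class the quotient is 0 by the convention on the inverse of 0. *)
have [->|c0] := posnP c; first by rewrite invr0 mulr0 divr_ge0 ?ler0n.
rewrite ler_pdivrMr ?ltr0n // mulrAC ler_pdivlMr ?ltr0n // -!natrM ler_nat.
nia.
Unshelve. all: by end_near.
Qed.
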